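(* For any integer $d\ge 2$ and any $\gamma\in(0,1)$, there are a $\gamma$-H\''older function $f\colon\mathbb{R}^{d-1}\to\mathbb{R}$ and a self-similar doubling measure $\nu$ on $\mathbb{R}^d$ such that the graph of $f$ has positive measure with respect to $\nu$.
   Context: A (nonzero, locally finite) Borel measure $\nu$ on $\mathbb{R}^d$ is doubling if there is a constant $C>1$ such that $\nu(B(x,2r))\le C\,\nu(B(x,r))$ for all $x\in\mathbb{R}^d$ and $r>0$. A function $f$ is $\gamma$-H\''older if there is $C$ with $|f(y)-f(y')|\le C|y-y'|^\gamma$ for all $y,y'$. ''Self-similar measure on $\mathbb{R}^d$'' is understood as follows: up to an isometry of $\mathbb{R}^d$, $\nu$ is the $\mathbb{Z}^d$-periodic extension $\sum_{z\in\mathbb{Z}^d}\eta(\cdot-z)$ of a self-similar Borel probability measure $\eta$ on $[0,1]^d$, i.e. one satisfying $\eta=\sum_{i=1}^m p_i\,\eta\circ S_i^{-1}$ for finitely many contracting similarities $S_1,\dots,S_m$ of $\mathbb{R}^d$ and positive weights $p_i$ with $\sum_i p_i=1$. *)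

(* Defs.v *)
From HB Require Import structures.
From mathcomp Require Import all_boot all_order all_algebra.
From mathcomp Require Import all_classical all_reals all_analysis.
Set Implicit Arguments.
Unset Strict Implicit.
Unset Printing Implicit Defensive.
Import Order.TTheory GRing.Theory Num.Theory.
Import numFieldNormedType.Exports.
Local Open Scope classical_set_scope.
Local Open Scope ring_scope.

(* The norm that the library puts on 'rV[R]_d is the sup norm. It induces the
   usual topology, but balls, isometries and similarities below refer to the
   Euclidean norm. *)
Definition enorm (R : realType) (d : nat) (x : 'rV[R]_d) : R :=
  Num.sqrt (\sum_(i < d) x 0 i ^+ 2).

Definition eball (R : realType) (d : nat) (x : 'rV[R]_d) (r : R) :
    set 'rV[R]_d :=
  [set y | enorm (y - x) < r].

(* R^d with its Borel sigma-algebra *)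
Definition borelRV (R : realType) (d : nat) :=
  g_sigma_algebraType (@open 'rV[R]_d).

Section measures.
Variables (R : realType) (d : nat).

Definition locally_finite_measure (nu : {measure set (borelRV R d) -> \bar R}) :=
  forall x : 'rV[R]_d, exists U, open_nbhs x U /\ (nu U < +oo)%E.

Definition doubling (nu : {measure set (borelRV R d) -> \bar R}) :=
  [/\ nu setT != 0%E, locally_finite_measure nu &
      exists C : R, 1 < C /\
        forall (x : 'rV[R]_d) (r : R), 0 < r ->
          (nu (eball x (2 * r)) <= C%:E * nu (eball x r))%E].

Definition isometry (g : 'rV[R]_d -> 'rV[R]_d) :=
  forall x y, enorm (g x - g y) = enorm (x - y).

Definition contracting_similarity (S : 'rV[R]_d -> 'rV[R]_d) :=
  exists r : R, [/\ 0 < r, r < 1 &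
    forall x y, enorm (S x - S y) = r * enorm (x - y)].

Definition unit_cube : set 'rV[R]_d := [set x | forall i, 0 <= x 0 i <= 1].

Definition self_similar_probability (eta : probability (borelRV R d) R) :=
  exists (m : nat) (S : 'I_m -> 'rV[R]_d -> 'rV[R]_d) (p : 'I_m -> R),
    [/\ forall i, contracting_similarity (S i),
        forall i, 0 < p i,
        \sum_(i < m) p i = 1 &
        forall A : set (borelRV R d), measurable A ->
          eta A = (\sum_(i < m) (p i)%:E * eta (S i @^-1` A))%E].

(* sum over z in Z^d of eta (. - z); A - z is the preimage of A under x |-> x + z *)
Definition periodic_extension (eta : set (borelRV R d) -> \bar R)
    (A : set (borelRV R d)) : \bar R :=
  \esum_(z in [set: 'rV[int]_d])
    eta ((fun x : 'rV[R]_d => x + map_mx (fun k : int => k%:~R) z) @^-1` A).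

Definition self_similar_measure (nu : {measure set (borelRV R d) -> \bar R}) :=
  exists (eta : probability (borelRV R d) R) (g : 'rV[R]_d -> 'rV[R]_d),
    [/\ eta unit_cube = 1%E, self_similar_probability eta, isometry g &
        forall A : set (borelRV R d), measurable A ->
          nu A = periodic_extension eta (g @^-1` A)].

End measures.

Definition hoelder_continuous (R : realType) (n : nat) (gamma : R)
    (f : 'rV[R]_n -> R) :=
  exists C : R, forall y y', `|f y - f y'| <= C * enorm (y - y') `^ gamma.

(* The point (x, f x) of R^d: coordinates j < d.-1 are those of x, and insub
   fails exactly at the last coordinate (0 < d). *)
Definition graph_point (R : realType) (d : nat) (f : 'rV[R]_d.-1 -> R)
    (x : 'rV[R]_d.-1) : 'rV[R]_d :=
  \row_(j < d) if insub (val j) is Some i then x 0 i else f x.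

Definition graph_of (R : realType) (d : nat) (f : 'rV[R]_d.-1 -> R) :
    set 'rV[R]_d :=
  [set graph_point f x | x in [set: 'rV[R]_d.-1]].

(* Main.v *)
Require Import Defs.
From HB Require Import structures.
From mathcomp Require Import all_boot all_order all_algebra.
From mathcomp Require Import all_classical all_reals all_analysis.
From mathcomp Require Import zify ring lra.
Set Implicit Arguments.
Unset Strict Implicit.
Unset Printing Implicit Defensive.
Import Order.TTheory GRing.Theory Num.Theory.
Import numFieldNormedType.Exports.
Local Open Scope classical_set_scope.
Local Open Scope ring_scope.

(** Divide the unit cube into N^d cells and let one interior cell carry almost
    all the mass, the others an equal, tiny share. The self-similar measure
    [eta] with these weights has very small dimension, and its periodic
    extension is doubling: once the addresses of two adjacent cells have split,
    all their later digits lie on the boundary of the grid, where the weights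
    agree.

    With positive probability the first n digits of a point contain, for every
    n, at most n/s noncentral ones. Only C^n cells of generation n contain such
    good points, where C is small compared with N^(1-gamma). Hence for most
    directions in the plane of the first and last coordinates, no two good
    points x, y at distance N^(-gamma n) differ by less than N^(-n) in that
    direction: each pair of cells excludes a set of slopes of length
    O(N^(-(1-gamma)n)). After a rotation the last coordinate is therefore a
    gamma-Hoelder function of the first one on the good points, and it extends
    to the whole hyperplane.

    To avoid infinite products, [eta] is realised as the image of Lebesgue
    measure on [0, 1[ under the map that replaces the base-L digits of t by
    cells, most of the L symbols standing for the central cell. *)

(** * Cells and their multiplicities *)

Section Cells.
Variables (d N L : nat) (kap : nat -> 'rV[int]_d).

(* The address of the [n]-th generation cell of [m]: the [n] lowest base-[L]
   digits of [m] become base-[N] digit vectors, and the rest of [m] is sent to a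
   lattice point by [e]. *)
Fixpoint cell (e : int -> 'rV[int]_d) (n : nat) (m : int) : 'rV[int]_d :=
  if n is n'.+1 then N%:Z *: cell e n' (m %/ L)%Z + kap `|(m %% L)%Z|%N else e m.

Definition cell0 := cell (fun=> 0).

Lemma cellE e n m : cell e n m = cell0 n m + (N ^ n)%:Z *: e (m %/ (L ^ n)%N)%Z.
Proof.
rewrite /cell0; elim: n m => [|n IHn] m /=; first by rewrite expn0 divz1 scale1r add0r.
rewrite IHn scalerDr scalerA -PoszM expnS addrAC; congr (_ + _ *: e _).
by rewrite expnS PoszM divzMA_ge0.
Qed.

Lemma cellS e n m : cell e n.+1 m = cell (cell e 1) n m.
Proof. by elim: n m => [//|n IHn] m; rewrite [LHS]/= -/(cell e n.+1 _) IHn. Qed.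

Lemma cell0_period (L_gt0 : (0 < L)%N) n (m z : int) : cell0 n (m + z * (L ^ n)%N%:Z) = cell0 n m.
Proof.
have L0 : L%:Z != 0 by lia.
rewrite /cell0; elim: n m z => [//|n IHn] m z /=.
by rewrite expnSr PoszM mulrA [m + _]addrC divzMDl // modzMDl [_ + (m %/ L)%Z]addrC IHn.
Qed.

Definition vdiv (k : 'rV[int]_d) : 'rV[int]_d := map_mx (fun x => (x %/ N)%Z) k.
Definition vmod (k : 'rV[int]_d) : 'rV[int]_d := map_mx (fun x => (x %% N)%Z) k.

Hypothesis kap_range : forall l j, 0 <= kap l 0 j < N%:Z.

Lemma N_gt0 : (0 < d)%N -> (0 < N)%N.
Proof. by case: d kap kap_range => // d' k /(_ 0%N 0) + _; lia. Qed.

Lemma eq_cell_step (k k' : 'rV[int]_d) l :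
  (N%:Z *: k + kap l == k') = (k == vdiv k') && (kap l == vmod k').
Proof.
apply/eqP/andP => [<-|[/eqP-> /eqP->]].
  split; apply/eqP/rowP => j; rewrite !mxE.
    have [kl1 kl2] := andP (kap_range l j).
    have N0 : N%:Z != 0 by lia.
    by rewrite mulrC divzMDl // divz_small ?addr0 // kl1.
  have [kl1 kl2] := andP (kap_range l j).
  by rewrite mulrC modzMDl modz_small // kl1.
by apply/rowP => j; rewrite !mxE mulrC -divz_eq.
Qed.

Variables (e : int -> 'rV[int]_d) (e' : 'rV[int]_d -> int).
Hypotheses (eK : cancel e e') (e'K : cancel e' e).
Hypothesis L_gt0 : (0 < L)%N.

Definition mult (i : 'rV[int]_d) := count (fun l => kap l == i) (iota 0 L).

(* The integers whose cell is [k]: their number is [L ^ n] times the mass of [k]. *)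
Fixpoint precell (n : nat) (k : 'rV[int]_d) : seq int :=
  if n is n'.+1 then
    [seq m * L%:Z + l%:Z | m <- precell n' (vdiv k),
       l <- [seq l <- iota 0 L | kap l == vmod k]]
  else [:: e' k].

Lemma mem_precell n k m : (m \in precell n k) = (cell e n m == k).
Proof.
have L0 : L%:Z != 0 by lia.
elim: n k m => [|n IHn] k m /=; first by rewrite inE -(can2_eq eK e'K) eq_sym eq_sym.
rewrite eq_cell_step -IHn.
apply/allpairsP/andP => [[[a l] /= [ha]]|[ha hl]].
  rewrite mem_filter mem_iota => /andP[hl hlL] ->.
  by rewrite divzMDl // modzMDl divz_small ?modz_small ?addr0 ?absz_nat //; lia.
have mL : 0 <= (m %% L)%Z < L%:Z by rewrite modz_ge0 // ltz_pmod //; lia.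
exists ((m %/ L)%Z, `|(m %% L)%Z|%N); split => //=.
  by rewrite mem_filter hl mem_iota; lia.
by rewrite gez0_abs ?(andP mL).1 // -divz_eq.
Qed.

Lemma precell_uniq n k : uniq (precell n k).
Proof.
have L0 : L%:Z != 0 by lia.
elim: n k => [//|n IHn] k /=; apply: allpairs_uniq => //.
  by rewrite filter_uniq ?iota_uniq.
move=> [a l] [b l'] /allpairsP[[a1 l1] /= [_ + [-> ->]]] /allpairsP[[b1 l2] /= [_ + [-> ->]]].
rewrite !mem_filter !mem_iota => /andP[_ h1] /andP[_ h2] E.
have := congr1 (fun x => (x %/ L)%Z) E; rewrite !divzMDl // !divz_small ?addr0; [|lia..].
by move=> ab; congr (_, _) => //; move: E; rewrite ab => /addrI [].
Qed.

Lemma size_precellS n k :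
  size (precell n.+1 k) = (size (precell n (vdiv k)) * mult (vmod k))%N.
Proof. by rewrite /= size_allpairs size_filter. Qed.

Hypothesis mult_gt0 : forall k, (0 < mult (vmod k))%N.
Hypothesis mult_bnd : forall k j, vmod k 0 j = 0 \/ vmod k 0 j = N%:Z - 1 ->
  mult (vmod k) = 1%N.

Lemma mult_leL i : (mult i <= L)%N.
Proof. by rewrite /mult (leq_trans (count_size _ _)) // size_iota. Qed.

Lemma divz_adj (x y : int) : (0 < N)%N -> `|x - y| <= 1 ->
  `|(x %/ N)%Z - (y %/ N)%Z| <= 1 /\ ((x %/ N)%Z != (y %/ N)%Z ->
   ((x %% N)%Z = 0 \/ (x %% N)%Z = N%:Z - 1) /\
   ((y %% N)%Z = 0 \/ (y %% N)%Z = N%:Z - 1)).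
Proof.
move=> N_gt0 xy.
have N0 : N%:Z != 0 by lia.
have Np : 0 < N%:Z by lia.
move: (divz_eq x N) (divz_eq y N) (modz_ge0 x N0) (modz_ge0 y N0) (ltz_pmod x Np) (ltz_pmod y Np).
move: (x %/ N)%Z (y %/ N)%Z (x %% N)%Z (y %% N)%Z => q q' r r' Ex Ey r0 r0' rN rN'.
have le : q - q' <= 1.
  rewrite leNgt; apply/negP => h.
  have : 0 <= (q - q' - 2) * N%:Z by rewrite mulr_ge0 //; lia.
  rewrite 2!mulrBl; lia.
have ge : q' - q <= 1.
  rewrite leNgt; apply/negP => h.
  have : 0 <= (q' - q - 2) * N%:Z by rewrite mulr_ge0 //; lia.
  rewrite 2!mulrBl; lia.
split; first by lia.
move=> /eqP qq'; have [E|E] : q = q' + 1 \/ q' = q + 1 by lia.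
  by move: Ex Ey; rewrite E mulrDl mul1r; lia.
by move: Ex Ey; rewrite E mulrDl mul1r; lia.
Qed.

(* If the parents of [k] and [k'] differ, then both last digits touch the
   boundary of the grid, and such digits have a single symbol. *)
Lemma size_precell_adj n (k k' : 'rV[int]_d) : (0 < d)%N -> (forall j, `|k 0 j - k' 0 j| <= 1) ->
  (size (precell n k) <= L * size (precell n k'))%N.
Proof.
move=> /N_gt0 N_gt0.
elim: n k k' => [|n IHn] k k' kk'; first by rewrite muln1.
rewrite !size_precellS; have [E|NE] := eqVneq (vdiv k) (vdiv k').
  rewrite E mulnCA leq_mul //.
  by rewrite (leq_trans (mult_leL _)) // leq_pmulr.
have [j /eqP kj] : exists j, vdiv k 0 j <> vdiv k' 0 j.
  by apply/existsNP => h; move/eqP: NE; apply; apply/rowP.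
have := divz_adj N_gt0 (kk' j); move: kj; rewrite !mxE => kj [_ /(_ kj)[b1 b2]].
rewrite (@mult_bnd k j) ?mxE // (@mult_bnd k' j) ?mxE // !muln1.
by apply: IHn => i; rewrite !mxE; exact: (divz_adj N_gt0 (kk' i)).1.
Qed.

Lemma size_precell_near M n (k k' : 'rV[int]_d) : (0 < d)%N -> (forall j, `|k 0 j - k' 0 j| <= M%:Z) ->
  (size (precell n k) <= L ^ M * size (precell n k'))%N.
Proof.
move=> d0; elim: M k k' => [|M IHM] k k' kk'.
  suff -> : k = k' by rewrite mul1n.
  by apply/rowP => j; have := kk' j; lia.
pose k2 : 'rV[int]_d := \row_j (k' 0 j + Num.sg (k 0 j - k' 0 j)).
have h1 j : `|k2 0 j - k' 0 j| <= 1 by rewrite mxE; lia.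
have h2 j : `|k 0 j - k2 0 j| <= M%:Z by rewrite mxE; have := kk' j; lia.
rewrite (leq_trans (IHM _ _ h2)) // expnSr -mulnA leq_mul2l.
by rewrite size_precell_adj // orbT.
Qed.

End Cells.

Section Symbols.
Variables (d N0 : nat).
Local Notation N := N0.+3.
Local Notation T := {ffun 'I_d -> 'I_N}.

Definition dvec (i : T) : 'rV[int]_d := \row_j (i j)%:Z.

Definition centre : T := [ffun=> inord 1].

(* The default of [nth] makes every symbol [l >= N ^ d] stand for the centre. *)
Definition kap (l : nat) : 'rV[int]_d := dvec (nth centre (enum T) l).

Lemma dvec_inj : injective dvec.
Proof.
move=> i i' /rowP h; apply/ffunP => j; apply/val_inj.
by have := h j; rewrite !mxE => -[].
Qed.

Lemma kap_range l j : 0 <= kap l 0 j < N%:Z.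
Proof. by rewrite mxE ltz_nat ltn_ord. Qed.

Lemma vmod_dvec k : exists i, vmod N k = dvec i.
Proof.
exists [ffun j => inord `|(k 0%R j %% N)%Z|%N]; apply/rowP => j; rewrite !mxE ffunE inordK.
  by rewrite gez0_abs // modz_ge0.
have := ltz_pmod (k 0 j) (isT : 0 < N%:Z); have := modz_ge0 (k 0 j) (isT : N%:Z != 0); lia.
Qed.

Lemma size_digits : size (enum T) = (N ^ d)%N.
Proof. by rewrite -cardE card_ffun !card_ord. Qed.

Variables (L : nat).
Hypothesis leL : (N ^ d <= L)%N.

Lemma iota_kap (a : pred 'rV[int]_d) :
  count (a \o kap) (iota 0 L) =
  (count (a \o dvec) (enum T) + (L - N ^ d) * a (dvec centre))%N.
Proof.
rewrite -(subnKC leL) iotaD count_cat addKn add0n; congr addn.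
  have E : enum T = [seq nth centre (enum T) l | l <- iota 0 (N ^ d)].
    by rewrite -size_digits -/(mkseq _ _) mkseq_nth.
  by rewrite [in RHS]E count_map.
rewrite (@eq_in_count _ _ (fun=> a (dvec centre))); last first.
  move=> l; rewrite mem_iota => /andP[h _] /=.
  by rewrite /kap nth_default // size_digits.
by case: (a _); rewrite ?count_predT ?count_pred0 ?size_iota ?muln1 ?muln0.
Qed.

Lemma mult_dvec i :
  mult L kap (dvec i) = (1 + (L - N ^ d) * (i == centre))%N.
Proof.
rewrite /mult (iota_kap (pred1 (dvec i))) /=; congr (_ + _ * _)%N.
  rewrite (eq_count (_ : _ =1 pred1 i)) ?count_uniq_mem ?enum_uniq ?mem_enum //.
  by move=> j /=; rewrite (inj_eq dvec_inj).
by rewrite (inj_eq dvec_inj) eq_sym.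
Qed.

Lemma mult_vmod_gt0 k : (0 < mult L kap (vmod N k))%N.
Proof. by have [i ->] := vmod_dvec k; rewrite mult_dvec. Qed.

Lemma mult_vmod_bnd k j : vmod N k 0 j = 0 \/ vmod N k 0 j = N%:Z - 1 ->
  mult L kap (vmod N k) = 1%N.
Proof.
have [i ->] := vmod_dvec k; rewrite mult_dvec mxE => h.
suff -> : (i == centre) = false by rewrite muln0.
by apply/eqP => E; move: h; rewrite E ffunE inordK //; lia.
Qed.

Definition central (k : 'rV[int]_d) : bool := k == dvec centre.

Lemma count_noncentral : (count (predC (central \o kap)) (iota 0 L) <= N ^ d)%N.
Proof.
rewrite (iota_kap (predC central)) /= /central eqxx /= muln0 addn0.
by rewrite (leq_trans (count_size _ _)) // size_digits.
Qed.

Fixpoint ncount (n : nat) (m : int) : nat :=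
  if n is n'.+1 then
    (ncount n' (m %/ L)%Z + ~~ central (kap `|(m %% L)%Z|))%N
  else 0%N.

Fixpoint words (n : nat) : seq int :=
  if n is n'.+1 then [seq m * L%:Z + l%:Z | m <- words n', l <- iota 0 L]
  else [:: 0].

Lemma L_gt0 : (0 < L)%N.
Proof. by rewrite (leq_trans _ leL) // expn_gt0. Qed.

Lemma mem_words n m : 0 <= m < (L ^ n)%N%:Z -> m \in words n.
Proof.
have L0 := L_gt0; have L0' : L%:Z != 0 by lia.
elim: n m => [|n IHn] m; first by rewrite expn0 inE; lia.
move=> /andP[m0 mL] /=; apply/allpairsP; exists ((m %/ L)%Z, `|(m %% L)%Z|%N).
have mp : 0 <= (m %% L)%Z < L%:Z by rewrite modz_ge0 // ltz_pmod.
split => /=; last by rewrite gez0_abs ?(andP mp).1 // -divz_eq.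
  apply: IHn; rewrite divz_ge0 // m0 /= -(@ltr_pM2r _ L%:Z) //.
  rewrite -PoszM -expnSr; apply: le_lt_trans mL.
  by rewrite {2}(divz_eq m L) lerDl (andP mp).1.
by rewrite mem_iota; lia.
Qed.

Lemma sum_words n s (hL : (N ^ d * 8 ^ s <= L)%N) :
  (\sum_(m <- words n) 8 ^ (s * ncount n m) <= (2 * L) ^ n)%N.
Proof.
have L0 := L_gt0; have L0' : L%:Z != 0 by lia.
elim: n => [|n IHn]; first by rewrite big_seq1 muln0.
rewrite /= big_allpairs_dep /=.
under eq_bigr => m _.
  under eq_big_seq => l.
    rewrite mem_iota => /andP[_ lL].
    rewrite divzMDl // modzMDl divz_small ?modz_small ?addr0 ?absz_nat; [|lia..].
    rewrite mulnDr expnD.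
    over.
  rewrite -big_distrr /=.
  over.
rewrite -big_distrl /= expnSr leq_mul //.
have -> : (\sum_(i <- iota 0 L) 8 ^ (s * ~~ central (kap i)) =
  \sum_(i <- iota 0 L) ((~~ central (kap i)) * 8 ^ s + central (kap i)))%N.
  by apply: eq_bigr => i _; case: central; rewrite /= ?muln0 ?muln1 ?mul1n ?addn0.
rewrite big_split /= -big_distrl /= mul2n -addnn leq_add //.
  apply: leq_trans hL; rewrite leq_mul2r; apply/orP; right.
  apply: leq_trans count_noncentral; rewrite -sum1_count [leqRHS]big_mkcond.
  by apply: leq_sum => i _ /=; case: central.
apply: leq_trans (_ : \sum_(i <- iota 0 L) 1 <= _)%N.
  by apply: leq_sum => i _; case: central.
by rewrite sum1_size size_iota.
Qed.

Definition bad_words s n := [seq m <- words n | (n < s * ncount n m)%N].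

(* Markov's inequality for the exponential moment bounded in [sum_words]. *)
Lemma size_bad_words s n (hL : (N ^ d * 8 ^ s <= L)%N) :
  (size (bad_words s n) * 4 ^ n <= L ^ n)%N.
Proof.
rewrite -(@leq_pmul2l (2 ^ n)) ?expn_gt0 // -expnMn.
apply: leq_trans (sum_words n hL); rewrite mulnCA -expnMn -[(2 * 4)%N]/8%N.
rewrite /bad_words size_filter -sum1_count big_distrl /= big_mkcond /=.
apply: leq_sum => m _; case: ifP => // h.
by rewrite mul1n leq_exp2l // ltnW.
Qed.

Fixpoint cells (n : nat) : seq ('rV[int]_d * nat) :=
  if n is n'.+1 then
    [seq (N%:Z *: p.1 + dvec i, (p.2 + (i != centre))%N) | p <- cells n', i <- enum T]
  else [:: (0, 0%N)].

Lemma mem_cells n m : (cell0 N L kap n m, ncount n m) \in cells n.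
Proof.
elim: n m => [|n IHn] m /=; first by rewrite inE.
apply/allpairsP; exists ((cell0 N L kap n (m %/ L)%Z, ncount n (m %/ L)%Z),
   nth centre (enum T) `|(m %% L)%Z|); split => //=; first by rewrite mem_enum.
by rewrite /central /kap (inj_eq dvec_inj).
Qed.

Definition sparse_cells s n := [seq p.1 | p <- cells n & (s * p.2 <= n)%N].

Lemma size_sparse_cells (R : realFieldType) (b : R) s n :
  1 <= b -> (N ^ d)%:R <= b ^+ s ->
  (size (sparse_cells s n))%:R <= (2 * b) ^+ n.
Proof.
move=> b1 bs; set B := (N ^ d)%N.
have B0 : 0 < B%:R :> R by rewrite ltr0n expn_gt0.
have b0 : 0 < b by rewrite (lt_le_trans _ b1).
have h : \sum_(p <- cells n) (B%:R^-1 : R) ^+ p.2 <= 2 ^+ n.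
  elim: n => [|n IHn]; first by rewrite big_seq1 expr0.
  rewrite /= big_allpairs_dep /=.
  under eq_bigr do under eq_bigr do rewrite exprD.
  under eq_bigr do rewrite -big_distrr /=.
  rewrite -big_distrl /= exprSr ler_pM //.
  - by rewrite sumr_ge0 // => p _; rewrite exprn_ge0 // invr_ge0 ltW.
  - by rewrite sumr_ge0 // => p _; rewrite exprn_ge0 // invr_ge0 ltW.
  rewrite (@big_enum _ _ _ _ T (fun i => (B%:R^-1 : R) ^+ (i != centre))) /=.
  rewrite (bigD1 centre) //= eqxx expr0 -[2]/(1 + 1) lerD2l.
  apply: le_trans (_ : \sum_(i : T) (B%:R^-1 : R) <= _).
    rewrite [leRHS](bigD1 centre) //= ler_wpDl ?invr_ge0 ?(ltW B0) //.
    by apply: ler_sum => i ic; rewrite ic expr1.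
  rewrite sumr_const card_ffun !card_ord -/B -[leLHS]mulr_natr mulVf //.
  by rewrite gt_eqF.
rewrite exprMn -ler_pdivrMr ?exprn_gt0 //; apply: le_trans h.
rewrite size_map size_filter -sum1_count natr_sum big_distrl /= big_mkcond /=.
apply: ler_sum => p _; case: ifP => [h|_]; last by rewrite exprn_ge0 // invr_ge0 ltW.
rewrite mul1r exprVn lef_pV2 ?posrE ?exprn_gt0 //.
apply: le_trans (_ : (b ^+ s) ^+ p.2 <= _); first by rewrite lerXn2r ?nnegrE ?exprn_ge0 ?(ltW b0) ?(ltW B0).
by rewrite -exprM ler_weXn2l.
Qed.

End Symbols.

(** * The coding map *)

Lemma expV_small (R : realType) (N : nat) (eps : R) : (1 < N)%N -> 0 < eps ->
  exists n, (N%:R ^+ n)^-1 < eps.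
Proof.
move=> N1 e0; pose n := (Num.trunc eps^-1).+1; exists n.
rewrite invf_plt ?posrE ?exprn_gt0 ?ltr0n ?(ltn_trans _ N1) //.
apply: lt_le_trans (truncnS_gt _) _.
by rewrite -natrX ler_nat ltnW // ltn_expl.
Qed.

Lemma expV_small_eq0 (R : realType) (N : nat) (x c : R) : (1 < N)%N ->
  (forall n, `|x| <= c * (N%:R ^+ n)^-1) -> x = 0.
Proof.
move=> N1 h; apply/eqP/negPn/negP => x0.
have x0' : 0 < `|x| by rewrite normr_gt0.
have c0 : 0 < c by have := h 0%N; rewrite expr0 invr1 mulr1; exact: lt_le_trans.
have [n] := expV_small N1 (divr_gt0 x0' c0).
by rewrite ltr_pdivlMr // mulrC ltNge h.
Qed.

Lemma floor_scale_div (R : realType) (L : nat) (x : R) : (0 < L)%N ->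
  (Num.floor (L%:R * x) %/ L)%Z = Num.floor x.
Proof.
move=> L0; have L0' : L%:Z != 0 by lia.
have Lp : 0 < L%:R :> R by rewrite ltr0n.
apply/esym/floor_def; set q := Num.floor (L%:R * x).
have [h1 h2] : q%:~R <= L%:R * x /\ L%:R * x < (q + 1)%:~R.
  by split; [exact: floor_le | exact: floorD1_gt].
have m0 : 0 <= (q %% L)%Z by rewrite modz_ge0.
have m1 : (q %% L)%Z < L%:Z by rewrite ltz_pmod //; lia.
have E := divz_eq q L.
apply/andP; split.
  rewrite -(ler_pM2l Lp); apply: le_trans h1.
  by rewrite -[L%:R]/(L%:Z%:~R) -intrM ler_int; lia.
rewrite -(ltr_pM2l Lp); apply: lt_le_trans h2 _.
by rewrite -[L%:R]/(L%:Z%:~R) -intrM ler_int mulrDr; lia.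
Qed.

Section Coding.
Variables (R : realType) (d N0 L : nat).
Local Notation N := N0.+3.
Hypothesis leL : (N ^ d <= L)%N.
Local Notation K := (@kap d N0).
Local Notation kcell := (@cell d N L K).
Implicit Types (e : int -> 'rV[int]_d) (t : R) (j : 'I_d).

Let L_gt0 : (0 < L)%N := L_gt0 leL.

Definition level (n : nat) t : int := Num.floor (L%:R ^+ n * t).

Lemma levelS n t : (level n.+1 t %/ L)%Z = level n t.
Proof. by rewrite /level exprS -mulrA floor_scale_div. Qed.

Lemma level0 t : level 0 t = Num.floor t.
Proof. by rewrite /level expr0 mul1r. Qed.

Lemma level_floor n t : (level n t %/ (L ^ n)%N)%Z = Num.floor t.
Proof. by rewrite /level -natrX floor_scale_div // expn_gt0 L_gt0. Qed.

Definition lower e n t j : R := (kcell e n (level n t) 0 j)%:~R / N%:R ^+ n.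

Lemma Nexp_gt0 n : 0 < N%:R ^+ n :> R.
Proof. by rewrite exprn_gt0 // ltr0n. Qed.

Lemma lower_step e n t j : lower e n t j <= lower e n.+1 t j /\
  lower e n.+1 t j + (N%:R ^+ n.+1)^-1 <= lower e n t j + (N%:R ^+ n)^-1.
Proof.
rewrite /lower /= levelS !mxE.
have /andP[k0 k1] := kap_range N0 `|(level n.+1 t %% L)%Z| j; rewrite mxE in k0 k1.
set k := Posz _ in k0 k1 *; set c := cell _ _ _ _ _ _.
have Np : 0 < N%:R :> R by rewrite ltr0n.
have Nn := Nexp_gt0 n.
have k0' : 0 <= k%:~R :> R by rewrite ler0z.
have k1' : (k%:~R : R) + 1 <= N%:R by rewrite -[N%:R]/(N%:Z%:~R) -[1]/(1%:~R) -intrD ler_int; lia.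
rewrite intrD intrM exprS invfM.
set a := (c 0 j)%:~R : R; set M := (N%:R ^+ n : R) in Nn *.
have -> : (N%:~R * a + k%:~R) * (N%:R^-1 * M^-1) = a / M + k%:~R * (N%:R^-1 * M^-1).
  rewrite -[N%:~R]/(N%:R : R) mulrDl; congr (_ + _).
  by rewrite mulrACA divff ?mul1r // gt_eqF.
have Mi : 0 <= M^-1 by rewrite invr_ge0 ltW.
split; first by rewrite lerDl !mulr_ge0 // invr_ge0 ltW.
rewrite -addrA lerD2l -[X in _ + X]mul1r -mulrDl mulrA ler_piMl //.
by rewrite ler_pdivrMr // mul1r.
Qed.

Lemma lower_le e n p t j : lower e n t j <= lower e (n + p) t j /\
  lower e (n + p) t j + (N%:R ^+ (n + p))^-1 <= lower e n t j + (N%:R ^+ n)^-1.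
Proof.
elim: p => [|p [h1 h2]]; first by rewrite addn0.
rewrite addnS; have [h3 h4] := lower_step e (n + p) t j.
by split; [exact: le_trans h3 | exact: le_trans h2].
Qed.

Lemma lower_upper e n p t j : lower e n t j <= lower e p t j + (N%:R ^+ p)^-1.
Proof.
have h q : 0 <= (N%:R ^+ q)^-1 :> R by rewrite invr_ge0 ltW // Nexp_gt0.
have [/subnKC E|/ltnW/subnKC E] := leqP n p.
  by have [le _] := lower_le e n (p - n) t j; rewrite E in le; rewrite (le_trans le) ?lerDl.
by have [_ le] := lower_le e p (n - p) t j; rewrite E in le; rewrite (le_trans _ le) ?lerDl.
Qed.

Definition coding e t : 'rV[R]_d := \row_j sup (range (fun n => lower e n t j)).

Lemma coding_bounds e n t j :
  lower e n t j <= coding e t 0 j <= lower e n t j + (N%:R ^+ n)^-1.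
Proof.
rewrite mxE; apply/andP; split.
  apply: ub_le_sup; last by exists n.
  by exists (lower e 0 t j + (N%:R ^+ 0)^-1) => _ [p _ <-]; exact: lower_upper.
apply: ge_sup; first by exists (lower e 0 t j), 0%N.
by move=> _ [p _ <-]; exact: lower_upper.
Qed.

Lemma coding_unique e t j (x : R) :
  (forall n, lower e n t j <= x <= lower e n t j + (N%:R ^+ n)^-1) -> x = coding e t 0 j.
Proof.
move=> h; apply/eqP; rewrite -subr_eq0; apply/eqP/(@expV_small_eq0 _ N _ 1) => // n.
have := h n; have := coding_bounds e n t j.
by rewrite mul1r ler_norml => /andP[? ?] /andP[? ?]; apply/andP; split; lra.
Qed.

Definition codept t := coding (fun=> 0) t.

Lemma codept01 t j : 0 <= codept t 0 j <= 1.
Proof. by have := coding_bounds (fun=> 0) 0 t j; rewrite /lower /= mxE mul0r add0r expr0 invr1. Qed.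

Lemma codingE e t : coding e t = codept t + map_mx (fun k : int => k%:~R) (e (Num.floor t)).
Proof.
apply/rowP => j; apply/esym/coding_unique => n.
have := coding_bounds (fun=> 0) n t j.
rewrite /lower [kcell e _ _]cellE !mxE level_floor /cell0 intrD intrM mulrDl -/(codept t).
have -> : (N ^ n)%N%:~R * (e (Num.floor t) 0 j)%:~R / N%:R ^+ n = (e (Num.floor t) 0 j)%:~R :> R.
  by rewrite mulrAC -[(N ^ n)%N%:~R]/((N ^ n)%N%:R : R) natrX divff ?mul1r // gt_eqF ?Nexp_gt0.
by rewrite addrAC !lerD2r.
Qed.

Lemma levelDz n t (z : int) : level n (t + z%:~R) = level n t + z * (L ^ n)%N%:Z.
Proof.
rewrite /level mulrDr -natrX -[(L ^ n)%:R]/((L ^ n)%N%:Z%:~R) -intrM floorDrz ?intr_int //.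
by rewrite intrKfloor [_ * z]mulrC.
Qed.

Lemma codept_period t (z : int) : codept (t + z%:~R) = codept t.
Proof.
apply/rowP => j; apply/esym/coding_unique => n.
have := coding_bounds (fun=> 0) n t j.
by rewrite /lower levelDz -/(cell0 N L K) cell0_period.
Qed.

Lemma codept_shift t l : 0 <= t < 1 -> (l < L)%N ->
  codept ((t + l%:R) / L%:R) = N%:R^-1 *: (codept t + map_mx (fun k : int => k%:~R) (K l)).
Proof.
move=> t01 lL; apply/rowP => j; apply/esym/coding_unique => -[|n].
  rewrite /lower /= !mxE mul0r add0r expr0 invr1.
  have := codept01 t j; rewrite /codept /coding !mxE => /andP[c0 c1].
  have /andP[k0 k1] := kap_range N0 l j; rewrite !mxE in k0 k1.
  have Np : 0 < N%:R :> R by rewrite ltr0n.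
  rewrite mulr_ge0 ?invr_ge0 ?(ltW Np) ?addr_ge0 ?ler0z // andTb ler_pdivrMl // mulr1.
  by rewrite -lezD1 -(ler_int R) intrD in k1; apply: le_trans k1; rewrite addrC lerD2l.
have -> : lower (fun=> 0) n.+1 ((t + l%:R) / L%:R) j =
    N%:R^-1 * (lower (fun=> 0) n t j + (K l 0 j)%:~R).
  rewrite /lower; set m := level n.+1 _.
  have -> : kcell (fun=> 0) n.+1 m = kcell (fun=> 0) n (level n t) + (N ^ n)%N%:Z *: K l.
    rewrite cellS cellE; have -> : m = level n t + l%:Z * (L ^ n)%N%:Z.
      rewrite -levelDz /m /level exprSr; congr Num.floor.
      by rewrite -mulrA; congr (_ * _); rewrite mulrC divfK // pnatr_eq0 -lt0n.
    rewrite cell0_period // [(level n t + _)%R]addrC divzMDl; last first.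
      by rewrite lt0n_neq0 // expn_gt0 L_gt0.
    rewrite level_floor (floor_def (m := 0)); last by rewrite add0r.
    by rewrite addr0 /cell scaler0 add0r modz_small ?absz_nat //; lia.
  rewrite 2!mxE intrD intrM -[(N ^ n)%N%:~R]/((N ^ n)%N%:R : R) natrX exprS.
  have Nn := Nexp_gt0 n; have Np : 0 < N%:R :> R by rewrite ltr0n.
  move: (N%:R ^+ n : R) (N%:R : R) Nn Np => M b M0 b0.
  by field; rewrite !gt_eqF.
have /andP[h1 h2] := coding_bounds (fun=> 0) n t j.
have -> : (N%:R^-1 *: (codept t + map_mx (fun k : int => k%:~R) (K l))) 0 j =
   N%:R^-1 * (codept t 0 j + (K l 0 j)%:~R) 
  by rewrite mxE; congr (_ * _); rewrite mxE; congr (_ + _); rewrite mxE.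
rewrite exprS invfM -mulrDr !ler_pM2l ?invr_gt0 ?ltr0n // lerD2r h1 /=.
by rewrite addrAC lerD2r.
Qed.

End Coding.

Lemma ex_pushforward d d' (T : measurableType d) (T' : measurableType d')
    (R : realType) (m : {measure set T -> \bar R}) (f : T -> T') :
  measurable_fun setT f ->
  exists nu : {measure set T' -> \bar R}, forall A, nu A = m (f @^-1` A).
Proof.
move=> mf; unshelve eexists.
  refine (pushforward m f : {measure set T' -> \bar R}); exact: mf.
by [].
Qed.

Section NormalizedMeasure.
Context d (T : measurableType d) (R : realType) (m : {measure set T -> \bar R}).
Hypothesis m1 : m setT = 1%E.

Definition normalized of m setT = 1%E : set T -> \bar R := m.

HB.instance Definition _ := Measure.copy (normalized m1) m.
HB.instance Definition _ := Measure_isProbability.Build _ _ _ (normalized m1) m1.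

Lemma ex_probability : exists P : probability T R, forall A, P A = m A.
Proof. by exists (normalized m1). Qed.

End NormalizedMeasure.

Lemma lebesgue_affine (R : realType) (a b : R) (A : set R) : 0 < a ->
  measurable A ->
  (lebesgue_measure ((fun t : R => (a * t + b)%R) @^-1` A) = a^-1%:E * lebesgue_measure A)%E.
Proof.
move=> a0 mA.
have mf : measurable_fun [set: measurableTypeR R] ((fun t : R => a * t + b) : measurableTypeR R -> measurableTypeR R).
  by apply: measurable_realfun.measurable_funD => //; apply: measurable_realfun.measurable_funM.
have [nu nuE] := ex_pushforward (@lebesgue_measure R) mf.
have a0' : 0 <= a by exact: ltW.
pose c := NngNum a0'.
have -> : lebesgue_measure A =
    (a%:E * lebesgue_measure ((fun t : R => (a * t + b)%R) @^-1` A))%E.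
  rewrite -nuE; apply: (@lebesgue_measure_unique R (mscale c nu) _ A mA).
  move=> _ [[x y]] /= _ <-; rewrite /mscale /= nuE.
  rewrite (_ : _ @^-1` _ = `](x - b) / a, (y - b) / a]%classic); last first.
    apply/seteqP; split => t /=; rewrite !in_itv /= ltr_pdivrMr // ler_pdivlMr // mulrC ltrBlDr lerBrDr //.
  rewrite -[X in (_ * X)%E]/(lebesgue_measure `](x - b) / a, (y - b) / a]%classic).
  rewrite [X in (_ * X)%E]lebesgue_measure_itv.
  rewrite lebesgue_measure_itv /= !lte_fin ltr_pM2r ?invr_gt0 // ltrD2r.
  case: ifP => _; last by rewrite mule0.
  by rewrite -!EFinD -EFinM; congr (_%:E); field; rewrite gt_eqF.
by rewrite muleA -EFinM mulVf ?mul1e // gt_eqF.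
Qed.

Section LevelMeasure.
Variables (R : realType) (L : nat).
Hypothesis L_gt0 : (0 < L)%N.
Local Notation leb := (@lebesgue_measure R).

Lemma level_itv n (m : int) :
  [set t : R | level L n t = m] = `[m%:~R / L%:R ^+ n, (m + 1)%:~R / L%:R ^+ n[%classic.
Proof.
have Ln : 0 < L%:R ^+ n :> R by rewrite exprn_gt0 // ltr0n.
apply/seteqP; split => t /=; rewrite in_itv /= ler_pdivrMr // ltr_pdivlMr // ![t * _]mulrC.
  by move=> <-; rewrite /level floor_le floorD1_gt.
by move=> h; apply: floor_def.
Qed.

Lemma measurable_level n (m : int) :
  measurable ([set t | level L n t = m] : set (measurableTypeR R)).
Proof. by rewrite level_itv; exact: measurable_itv. Qed.

Lemma measurable_level_preimage n (M : set int) :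
  measurable ([set t | M (level L n t)] : set (measurableTypeR R)).
Proof.
rewrite (_ : [set t | _] = \bigcup_m ([set t | level L n t = m] `&` [set _ | M m])).
  apply: countable_bigcupT_measurable => // m.
  apply: measurableI; first exact: measurable_level.
  have [h|h] := pselect (M m).
    by rewrite (_ : [set _ | _] = setT) //; apply/seteqP; split.
  by rewrite (_ : [set _ | _] = set0) //; apply/seteqP; split.
apply/seteqP; split => t /=; first by move=> h; exists (level L n t).
by move=> [m _ [/= -> ]].
Qed.

Lemma lebesgue_level n (m : int) :
  leb [set t | level L n t = m] = ((L%:R ^+ n)^-1)%:E.
Proof.
have Ln : 0 < L%:R ^+ n :> R by rewrite exprn_gt0 // ltr0n.
rewrite level_itv lebesgue_measure_itv /= lte_fin ltr_pM2r ?invr_gt0 //.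
rewrite ltr_int ltrDl ltr01 -EFinD -mulrBl intrD addrAC subrr add0r.
by rewrite mul1r.
Qed.

Lemma lebesgue_level_seq n (s : seq int) : uniq s ->
  leb [set t | level L n t \in s] = ((size s)%:R / L%:R ^+ n)%:E.
Proof.
elim: s => [_|m s IHs /= /andP[ms us]].
  by rewrite (_ : [set t | _] = set0) ?measure0 ?mul0r //; apply/seteqP; split.
rewrite (_ : [set t | _] = [set t | level L n t = m] `|` [set t | level L n t \in s]).
  rewrite measureU /= ?lebesgue_level ?IHs //.
  - by rewrite -EFinD -[in RHS]addn1 natrD mulrDl addrC mul1r.
  - exact: measurable_level.
  - exact: (measurable_level_preimage n (fun m => m \in s)).
  - by apply/seteqP; split => // t /= [tm]; rewrite tm (negbTE ms).
apply/seteqP; split => t /=; rewrite inE.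
  by move=> /orP[/eqP|]; [left|right].
by move=> [->|->]; rewrite ?eqxx ?orbT.
Qed.

Lemma lebesgue_level_le n (s : seq int) :
  (leb [set t | level L n t \in s] <= ((size s)%:R / L%:R ^+ n)%:E)%E.
Proof.
have Ln : 0 < L%:R ^+ n :> R by rewrite exprn_gt0 // ltr0n.
rewrite (_ : [set t | _] = [set t | level L n t \in undup s]); last first.
  by apply/seteqP; split => t /=; rewrite mem_undup.
rewrite lebesgue_level_seq ?undup_uniq // lee_fin ler_pM2r ?invr_gt0 //.
by rewrite ler_nat size_undup.
Qed.

End LevelMeasure.

Section CodingMeasurable.
Variables (R : realType) (d N0 L : nat).
Local Notation N := N0.+3.
Hypothesis leL : (N ^ d <= L)%N.

Lemma measurable_coding (e : int -> 'rV[int]_d) (g : 'rV[R]_d -> 'rV[R]_d) :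
  continuous g ->
  measurable_fun [set: measurableTypeR R]
    ((g \o @coding R d N0 L e) : measurableTypeR R -> borelRV R d).
Proof.
move=> cg; apply: (@measurability _ _ (measurableTypeR R) (borelRV R d) setT _ (@open 'rV[R]_d)).
  by [].
move=> _ [U oU <-].
rewrite setTI comp_preimage.
have oV : open (g @^-1` U) by apply: open_comp => // x _; exact: cg.
move: (g @^-1` U) oV => V oV.
pose box (n : nat) (m : int) := [set x : 'rV[R]_d | forall j,
  (cell N L (@kap d N0) e n m 0 j)%:~R / N%:R ^+ n <= x 0 j <=
  (cell N L (@kap d N0) e n m 0 j)%:~R / N%:R ^+ n + (N%:R ^+ n)^-1].
rewrite (_ : _ @^-1` _ = \bigcup_n [set t | box n (level L n t) `<=` V]).
  apply: bigcupT_measurable => n.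
  exact: (measurable_level_preimage (L_gt0 leL) n (fun m => box n m `<=` V)).
have inbox n t : box n (level L n t) (coding N0 L e t).
  by move=> j; exact: coding_bounds.
apply/seteqP; split => t /=; last by move=> [n _]; apply.
move=> Vt; have : nbhs (coding N0 L e t : 'rV[R]_d) V by exact: open_nbhs_nbhs.
move=> /nbhs_ballP[eps /= e0 sub].
have [n Nn] := expV_small (isT : (1 < N)%N) e0.
exists n => // x bx; apply: sub; split => // i j; rewrite ord1 /ball /=.
have := bx j; have := inbox n t j.
move=> /andP[h1 h2] /andP[h3 h4]; rewrite ltr_norml; apply/andP; split; lra.
Qed.

End CodingMeasurable.

(** * The self-similar measure and its periodic extension *)

Lemma ex_enumeration (T : countType) (f : nat -> T) : injective f ->
  exists b : nat -> T, bijective b.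
Proof.
move=> injf; have inf : infinite_set [set: T].
  move=> fin; apply: infinite_nat; rewrite -(preimage_setT f).
  by apply: finite_preimage => // x y _ _; exact: injf.
have /pcard_eqP[h] := eq_card_nat (countableP [set: T]) inf.
have [b hK bK] : bijective h by exact: bijTT.
by exists b, h.
Qed.

Lemma ex_lattice_enumeration d : (0 < d)%N ->
  exists e : int -> 'rV[int]_d, bijective e.
Proof.
case: d => // d _.
have [i [i' iK i'K]] : exists i : nat -> int, bijective i.
  by apply: (@ex_enumeration _ Posz) => x y [].
have [b bbij] : exists b : nat -> 'rV[int]_d.+1, bijective b.
  apply: (@ex_enumeration _ (fun n => const_mx n%:Z)) => x y /rowP /(_ 0).
  by rewrite !mxE => -[].
by exists (b \o i'); apply: bij_comp => //; exists i.
Qed.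

(* No measurability is needed: [lebesgue_measure] is an outer measure. *)
Lemma le_lebesgue (R : realType) (A B : set R) : A `<=` B ->
  (lebesgue_measure A <= lebesgue_measure B)%E.
Proof. by move=> AB; rewrite /lebesgue_measure /lebesgue_stieltjes_measure /measure_extension; exact: le_mu_ext. Qed.

Lemma enormZ (R : realType) d (a : R) (x : 'rV[R]_d) : 0 <= a ->
  enorm (a *: x) = a * enorm x.
Proof.
move=> a0; rewrite /enorm; under eq_bigr do rewrite mxE exprMn.
by rewrite -mulr_sumr sqrtrM ?sqr_ge0 // sqrtr_sqr ger0_norm.
Qed.

Section SelfSimilar.
Variables (R : realType) (d N0 L : nat).
Local Notation N := N0.+3.
Hypothesis leL : (N ^ d <= L)%N.
Local Notation leb := (@lebesgue_measure R).
Local Notation codept := (@codept R d N0 L).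
Local Notation toR := (map_mx (fun k : int => k%:~R : R)).
Let L_gt0 : (0 < L)%N := L_gt0 leL.

Definition code_measure (eta : set (borelRV R d) -> \bar R) :=
  forall A, eta A = leb (codept @^-1` A `&` [set t | Num.floor t = 0]).

Lemma floor0_itv : [set t : R | Num.floor t = 0] = `[0, 1[%classic.
Proof.
apply/seteqP; split => t /=; rewrite in_itv /=.
  by move=> h; have := floor_le t; have := floorD1_gt t; rewrite h add0r => -> ->.
by move=> h; apply: floor_def; rewrite add0r.
Qed.

Lemma measurable_code_preimage A : measurable (A : set (borelRV R d)) ->
  measurable (codept @^-1` A : set (measurableTypeR R)).
Proof.
move=> mA; have := @measurable_coding R d N0 L leL (fun=> 0) idfun _.
by move=> /(_ (fun x => cvg_id) measurableT A mA); rewrite setTI.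
Qed.

Lemma ex_code_measure : exists P : probability (borelRV R d) R, code_measure P.
Proof.
have mI : measurable ([set t : R | Num.floor t = 0] : set (measurableTypeR R)).
  by rewrite floor0_itv; exact: measurable_itv.
have mc : measurable_fun setT (codept : measurableTypeR R -> borelRV R d).
  move=> _ A mA; rewrite setTI; exact: measurable_code_preimage.
have [nu nuE] := ex_pushforward (mrestr leb mI) mc.
have nu1 : nu setT = 1%E.
  rewrite nuE preimage_setT /= /mrestr setTI floor0_itv lebesgue_measure_itv /=.
  by rewrite lte_fin ltr01 -EFinD subr0.
have [P PE] := ex_probability nu1.
by exists P => A; rewrite PE nuE.
Qed.

Lemma code_measure_cube (eta : set (borelRV R d) -> \bar R) :
  code_measure eta -> eta (@unit_cube R d) = 1%E.
Proof.
move=> ->; rewrite (_ : _ @^-1` _ = setT); last first.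
  by apply/seteqP; split => // t _ j; exact: codept01.
by rewrite setTI floor0_itv lebesgue_measure_itv /= lte_fin ltr01 -EFinD subr0.
Qed.

Definition contraction (l : 'I_L) (x : 'rV[R]_d) : 'rV[R]_d :=
  N%:R^-1 *: (x + toR (kap d N0 l)).

Lemma contraction_similarity l : contracting_similarity (contraction l).
Proof.
have Np : 0 < N%:R :> R by rewrite ltr0n.
exists N%:R^-1; split; first by rewrite invr_gt0.
  by rewrite invf_lt1 // ltr1n.
move=> x y; rewrite /contraction -scalerBr enormZ ?invr_ge0 ?(ltW Np) //.
by rewrite opprD addrACA subrr addr0.
Qed.

Lemma code_measure_similar (P : probability (borelRV R d) R) :
  code_measure P -> self_similar_probability P.
Proof.
move=> PE; exists L, contraction, (fun=> L%:R^-1).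
have Lp : 0 < L%:R :> R by rewrite ltr0n.
split; first exact: contraction_similarity.
- by move=> _; rewrite invr_gt0.
- by rewrite sumr_const card_ord -[LHS]mulr_natr mulVf // gt_eqF.
move=> A mA; rewrite PE.
pose F (l : 'I_L) := codept @^-1` A `&` [set t | level L 1 t = l :> int].
have mF l : measurable (F l : set (measurableTypeR R)).
  by apply: measurableI; [exact: measurable_code_preimage|exact: measurable_level].
have -> : codept @^-1` A `&` [set t | Num.floor t = 0] = \big[setU/set0]_(l < L) F l.
  rewrite -bigcup_seq; apply/seteqP; split => t /=.
    move=> [At t0]; have := level_floor leL 1 t; rewrite expn1 t0 => lev.
    have l0 : 0 <= level L 1 t < L%:Z.
      rewrite (divz_eq (level L 1 t) L) lev mul0r add0r modz_ge0 ?ltz_pmod //=; lia.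
    have [l lE] : exists l : nat, level L 1 t = l :> int by exists `|level L 1 t|%N; lia.
    have lL : (l < L)%N by lia.
    by exists (Ordinal lL); [rewrite /= mem_index_enum | split].
  move=> [l _ [At /= lE]]; split => //.
  by rewrite -(level_floor leL 1 t) lE expn1 divz_small //; have := ltn_ord l; lia.
rewrite measure_bigsetU_ord //=; last first.
  apply/trivIsetP => i j _ _ ij; apply/seteqP; split => // t [[_ /= h1] [_ /= h2]].
  have E : i = j by apply: val_inj; move: h2; rewrite h1 => -[].
  by rewrite E eqxx in ij.
apply: eq_bigr => l _; rewrite PE.
have Li0 : 0 < L%:R^-1 :> R by rewrite invr_gt0.
have := lebesgue_affine (l%:R / L%:R) Li0 (mF l); rewrite invrK => E.
rewrite (_ : _ `&` _ = (fun t : R => L%:R^-1 * t + l%:R / L%:R) @^-1` F l); last first.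
  have phiE (t : R) : L%:R^-1 * t + l%:R / L%:R = (t + l%:R) / L%:R by rewrite mulrC -mulrDl.
  have lev1 (t : R) : level L 1 ((t + l%:R) / L%:R) = Num.floor t + l%:Z.
    rewrite /level expr1 mulrC divfK ?gt_eqF // -[l%:R]/(l%:Z%:~R).
    by rewrite floorDrz ?intr_int // intrKfloor.
  apply/seteqP; split => t; rewrite /F /= phiE lev1.
    move=> [At t0]; split; last by rewrite t0 add0r.
    rewrite codept_shift //.
    by have : [set t | Num.floor t = 0] t by []; rewrite floor0_itv /= in_itv.
  move=> [At t0]; have t0' : Num.floor t = 0 by lia.
  split => //; move: At; rewrite codept_shift //.
  by have : [set t | Num.floor t = 0] t by []; rewrite floor0_itv /= in_itv.
by rewrite E muleA -EFinM mulVf ?mul1e // gt_eqF.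
Qed.

Lemma lebesgue_coding_preimage (e : int -> 'rV[int]_d) eta (B : set 'rV[R]_d) :
  bijective e -> code_measure eta ->
  measurable (coding N0 L e @^-1` B : set (measurableTypeR R)) ->
  leb (coding N0 L e @^-1` B) = periodic_extension eta B.
Proof.
move=> be etaE; set X := _ @^-1` B => mX.
have [i ibij] : exists i : nat -> int, bijective i.
  by apply: (@ex_enumeration _ Posz) => x y [].
pose F k := X `&` [set t | level L 0 t = i k].
have mF k : measurable (F k : set (measurableTypeR R)).
  by apply: measurableI => //; exact: measurable_level.
have -> : X = \bigcup_k F k.
  apply/seteqP; split => t; last by move=> [k _ []].
  move=> Xt; have [i' _ i'K] := ibij.
  by exists (i' (level L 0 t)) => //; split => //=; rewrite i'K.
have trF : trivIset setT F.
  apply/trivIsetP => k k' _ _ kk'; apply/seteqP; split => // t [[_ /= h1] [_ /= h2]].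
  have E : k = k' by apply: (bij_inj ibij); rewrite -h1 -h2.
  by rewrite E eqxx in kk'.
rewrite measure_bigcup //= (eq_eseriesl (Q := xpredT)); last by move=> k; rewrite in_setT.
have -> : periodic_extension eta B = \esum_(k in [set: nat])
    eta ((fun x => x + toR (e (i k))) @^-1` B).
  rewrite /periodic_extension (reindex_esum setT _ (e \o i)) //.
  by rewrite setTT_bijective; exact: bij_comp.
rewrite nneseries_esumT //; apply: eq_esum => k _.
have := lebesgue_affine (i k)%:~R ltr01 (mF k); rewrite invr1 mul1e => <-.
have FE (t : R) : F k (1 * t + (i k)%:~R) <->
    B (codept t + toR (e (i k))) /\ Num.floor t = 0.
  rewrite /F /X /= mul1r level0 codingE // codept_period // floorDrz ?intr_int //.
  rewrite intrKfloor; split => -[Bt t0].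
    have t0' : Num.floor t = 0 by apply: (addIr (i k)); rewrite t0 add0r.
    by rewrite t0' add0r in Bt.
  by rewrite t0 add0r.
by rewrite etaE; congr (leb _); apply/seteqP; split => t /=; rewrite FE.
Qed.

End SelfSimilar.

(** * Doubling *)

Lemma abs_le_enorm (R : realType) d (x : 'rV[R]_d) j : `|x 0 j| <= enorm x.
Proof.
rewrite /enorm -sqrtr_sqr ler_wsqrtr // (bigD1 j) //= lerDl sumr_ge0 // => i _.
exact: sqr_ge0.
Qed.

Lemma enorm_lt (R : realType) d (x : 'rV[R]_d) (r : R) : 0 < r ->
  (forall j, `|x 0 j| <= r / d.+1%:R) -> enorm x < r.
Proof.
move=> r0 h; rewrite /enorm -[ltRHS](gtr0_norm r0) -sqrtr_sqr ltr_sqrt ?exprn_gt0 //.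
apply: le_lt_trans (_ : \sum_(i < d) (r / d.+1%:R) ^+ 2 < _).
  by apply: ler_sum => i _; rewrite -real_normK ?num_real // lerXn2r ?nnegrE // (le_trans _ (h i)).
rewrite sumr_const card_ord -[ltLHS]mulr_natr expr_div_n -mulrA gtr_pMr ?exprn_gt0 //.
rewrite mulrC ltr_pdivrMr ?exprn_gt0 ?ltr0n // mul1r -natrX ltr_nat.
by apply: (@leq_trans (d.+1 ^ 1)); rewrite ?leq_pexp2l ?expn1.
Qed.

Section Boxes.
Variable d : nat.

Definition box (F : 'rV[int]_d) (w : nat) : seq 'rV[int]_d :=
  [seq \row_j (F 0 j + (f j)%:Z - w%:Z) | f : {ffun 'I_d -> 'I_w.*2.+1}].

Lemma size_box F w : size (box F w) = (w.*2.+1 ^ d)%N.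
Proof. by rewrite size_map -cardE card_ffun !card_ord. Qed.

Lemma box_uniq F w : uniq (box F w).
Proof.
rewrite map_inj_uniq ?enum_uniq // => f f' /rowP h; apply/ffunP => j.
by apply/val_inj; have := h j; rewrite !mxE /=; lia.
Qed.

Lemma mem_box (F : 'rV[int]_d) w (k : 'rV[int]_d) : reflect (forall j, `|k 0 j - F 0 j| <= w%:Z) (k \in box F w).
Proof.
apply: (iffP mapP) => [[f _ ->] j|h].
  rewrite mxE; move: (F 0 j) (nat_of_ord (f j)) (ltn_ord (f j)) => a b hb; rewrite addrAC [a + _]addrC addrK; lia.
exists [ffun j => inord `|(k 0 j - F 0 j + w%:Z)%R|%N]; first by rewrite mem_enum.
apply/rowP => j; have := h j; rewrite mxE ffunE ler_norml => /andP[h1 h2].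
have z0 : 0 <= k 0 j - F 0 j + w%:Z by rewrite -lerBlDr sub0r.
rewrite inordK ?gez0_abs //; first by rewrite addrA addrK addrC subrK.
have E : w.*2.+1%:Z = w%:Z + w%:Z + 1 by rewrite -addnn -addn1 !PoszD.
by rewrite -ltz_nat gez0_abs // E ltzD1 lerD2r.
Qed.

End Boxes.

Section Doubling.
Variables (R : realType) (d N0 L : nat).
Local Notation N := N0.+3.
Hypothesis leL : (N ^ d <= L)%N.
Hypothesis d_gt0 : (0 < d)%N.
Variables (e : int -> 'rV[int]_d) (e' : 'rV[int]_d -> int).
Hypotheses (eK : cancel e e') (e'K : cancel e' e).
Local Notation leb := (@lebesgue_measure R).
Local Notation K := (kap d N0).
Local Notation precell := (precell N L K e').
Local Notation cod := (@coding R d N0 L e).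
Let L_gt0 : (0 < L)%N := L_gt0 leL.

Definition boxcell n F w := [seq m | k <- box F w, m <- precell n k].

Lemma mem_boxcell n F w m :
  (m \in boxcell n F w) = (cell N L K e n m \in box F w).
Proof.
apply/allpairsPdep/idP => [[k [p [kb]]]|kb].
  by rewrite (mem_precell (kap_range N0) eK e'K L_gt0) => /eqP + ->; move=> ->.
exists (cell N L K e n m), m; split => //.
by rewrite (mem_precell (kap_range N0) eK e'K L_gt0).
Qed.

Lemma boxcell_uniq n F w : uniq (boxcell n F w).
Proof.
apply: allpairs_uniq_dep; first exact: box_uniq.
  by move=> k _; exact: precell_uniq.
move=> p q /allpairsPdep[k1 [m1 [_ h1 ->]]] /allpairsPdep[k2 [m2 [_ h2 ->]]] /= m12.
move: h1 h2; rewrite !(mem_precell (kap_range N0) eK e'K L_gt0) m12.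
by move=> /eqP <- /eqP <-.
Qed.

Lemma size_boxcell n F w : size (boxcell n F w) = \sum_(k <- box F w) size (precell n k).
Proof. by rewrite size_allpairs_dep sumnE big_map. Qed.

Lemma size_precell_box n F w k : k \in box F w ->
  (size (precell n k) <= L ^ w * size (precell n F))%N /\
  (size (precell n F) <= L ^ w * size (precell n k))%N.
Proof.
move=> /mem_box h.
have near := size_precell_near (kap_range N0) e' L_gt0 (mult_vmod_gt0 leL) (@mult_vmod_bnd d N0 L leL).
by split; apply: near => // j; rewrite // distrC.
Qed.

Definition centre_cell n (y : 'rV[R]_d) : 'rV[int]_d := \row_j Num.floor (y 0 j * N%:R ^+ n).

Lemma boxcell_lower n (y : 'rV[R]_d) w (X : set R) :
  (forall t, (forall j, `|cod t 0 j - y 0 j| * N%:R ^+ n <= w.+1%:R) -> X t) ->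
  (((size (boxcell n (centre_cell n y) w))%:R / L%:R ^+ n)%:E <= leb X)%E.
Proof.
move=> h; rewrite -(lebesgue_level_seq _ L_gt0 _ (boxcell_uniq _ _ _)).
apply: le_lebesgue => t /=; rewrite mem_boxcell => /mem_box kF; apply: h => j.
have Nn := Nexp_gt0 R N0 n.
have /andP[h1 h2] := coding_bounds leL e n t j.
have := kF j; rewrite mxE; set f := Num.floor _ => kf.
have f1 : f%:~R <= y 0 j * N%:R ^+ n := floor_le _.
have f2 : y 0 j * N%:R ^+ n < (f + 1)%:~R := floorD1_gt _.
move: h1 h2; rewrite /lower.
set k := cell _ _ _ _ _ _ 0 j in kf *; set M := (N%:R ^+ n : R) in Nn f1 f2 *.
move=> h1 h2.
have {}h1 : k%:~R <= cod t 0 j * M by rewrite -ler_pdivrMr.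
have {}h2 : cod t 0 j * M <= k%:~R + 1 by rewrite -ler_pdivlMr // mulrDl mul1r.
have kf' : `|k%:~R - f%:~R : R| <= w%:R.
  by rewrite -intrB -intr_norm -[w%:R]/(w%:Z%:~R) ler_int.
rewrite intrD in f2; move: kf'; rewrite ler_norml => /andP[kf1 kf2].
rewrite -[X in _ * X](gtr0_norm Nn) -normrM ler_norml -addn1 natrD mulrBl.
by apply/andP; split; lra.
Qed.

Lemma boxcell_upper n (y : 'rV[R]_d) w (c : R) (X : set R) :
  (forall t, X t -> forall j, `|cod t 0 j - y 0 j| <= c) -> c * N%:R ^+ n + 1 <= w%:R ->
  (leb X <= ((size (boxcell n (centre_cell n y) w))%:R / L%:R ^+ n)%:E)%E.
Proof.
move=> h cw; rewrite -(lebesgue_level_seq _ L_gt0 _ (boxcell_uniq _ _ _)).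
apply: le_lebesgue => t Xt /=; rewrite mem_boxcell; apply/mem_box => j.
have Nn := Nexp_gt0 R N0 n.
have /andP[h1 h2] := coding_bounds leL e n t j.
have {}h := h t Xt j.
rewrite mxE; set f := Num.floor _.
have f1 : f%:~R <= y 0 j * N%:R ^+ n := floor_le _.
have f2 : y 0 j * N%:R ^+ n < (f + 1)%:~R := floorD1_gt _.
move: h1 h2; rewrite /lower.
set k := cell _ _ _ _ _ _ 0 j; set M := (N%:R ^+ n : R) in Nn f1 f2 cw *.
move=> h1 h2.
have {}h1 : k%:~R <= cod t 0 j * M by rewrite -ler_pdivrMr.
have {}h2 : cod t 0 j * M <= k%:~R + 1 by rewrite -ler_pdivlMr // mulrDl mul1r.
rewrite intrD in f2.
have {}h : `|cod t 0 j * M - y 0 j * M| <= c * M.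
  by rewrite -mulrBl normrM (gtr0_norm Nn) ler_pM2r.
move: h; rewrite ler_norml => /andP[h3 h4].
rewrite -ltzD1 -(ltr_int R) intrD intr_norm intrB ltr_norml; apply/andP; split.
  by rewrite -[w%:~R]/(w%:R : R); lra.
by rewrite -[w%:~R]/(w%:R : R); lra.
Qed.

End Doubling.

Lemma ex_scale (R : realType) (N D : nat) (r : R) : (1 < N)%N -> (0 < D)%N -> 0 < r ->
  exists n w : nat, [/\ (D * w.+1)%:R <= r * N%:R ^+ n, r * N%:R ^+ n <= (D * w.+2)%:R &
    n = 0%N \/ (w < N)%N].
Proof.
move=> N1 D0 r0.
have Dp : 0 < D%:R :> R by rewrite ltr0n.
have Np n : 0 < N%:R ^+ n :> R by rewrite exprn_gt0 // ltr0n (ltn_trans _ N1).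
have ex : exists n, D%:R <= r * N%:R ^+ n.
  have [n] := expV_small N1 (divr_gt0 r0 Dp).
  rewrite ltr_pdivlMr // mulrC ltr_pdivrMr // => /ltW h.
  by exists n.
case: (ex_minnP ex) => n hn nmin.
have [w wE] : exists w, Num.trunc (r * N%:R ^+ n / D%:R) = w.+1.
  suff : (0 < Num.trunc (r * N%:R ^+ n / D%:R))%N by case: Num.trunc => // w _; exists w.
  by rewrite truncn_gt0 ler_pdivlMr // mul1r; exact: hn.
have /andP[w1 w2] : w.+1%:R <= r * N%:R ^+ n / D%:R < w.+2%:R.
  by rewrite -wE; apply: truncn_itv; rewrite ltW // divr_gt0 // mulr_gt0.
exists n, w; split.
- by rewrite natrM [D%:R * _]mulrC -ler_pdivlMr //; exact: w1.
- by rewrite natrM [D%:R * _]mulrC ltW // -ltr_pdivrMr //; exact: w2.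
case: n hn nmin {wE} w1 w2 => [|n] hn nmin w1 w2; [by left | right].
have : r * N%:R ^+ n < D%:R by rewrite ltNge; apply/negP => /nmin; rewrite ltnn.
move=> h; rewrite -(ler_nat R) (le_trans w1) // ler_pdivrMr // exprS mulrCA.
by rewrite ler_pM2l ?ltr0n ?(ltn_trans _ N1) // ltW.
Qed.

Section DoublingCoding.
Variables (R : realType) (d N0 L : nat).
Local Notation N := N0.+3.
Hypothesis leL : (N ^ d <= L)%N.
Hypothesis d_gt0 : (0 < d)%N.
Variables (e : int -> 'rV[int]_d) (e' : 'rV[int]_d -> int).
Hypotheses (eK : cancel e e') (e'K : cancel e' e).
Local Notation leb := (@lebesgue_measure R).
Local Notation cod := (@coding R d N0 L e).
Local Notation boxcell := (boxcell N0 L e').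
Local Notation D := d.+1.

Let L_gt0 : (0 < L)%N := L_gt0 leL.

Lemma size_boxcell_comparable n (F : 'rV[int]_d) (w : nat) :
  n = 0%N \/ (w < N)%N ->
  (size (boxcell n F (2 * D * w.+2 + 1)) <= ((8 * D + 5) ^ d * (L ^ (2 * D * N.+1 + 1)) ^ 2) *
     size (boxcell n F w))%N.
Proof.
move=> hn; set W := (2 * D * w.+2 + 1)%N; set Q := (L ^ _)%N.
have Q0 : (0 < Q)%N by rewrite expn_gt0 L_gt0.
pose s := size (precell N L (kap d N0) e' n F).
have near v k : (v <= W)%N -> k \in box F v ->
    (size (precell N L (kap d N0) e' n k) <= Q * s)%N /\
    (s <= Q * size (precell N L (kap d N0) e' n k))%N.
  move=> vW kb; case: hn => [n0|wN]; first by rewrite /s n0 /= muln1.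
  have [h1 h2] := size_precell_box leL d_gt0 e' n kb.
  have LQ : (L ^ v <= Q)%N by rewrite leq_pexp2l // (leq_trans vW) // /W leq_add2r leq_mul2l ltnS wN orbT.
  by split; [apply: leq_trans h1 _ | apply: leq_trans h2 _]; rewrite leq_mul2r LQ orbT.
clearbody Q.
have up : (size (boxcell n F W) <= (W.*2.+1) ^ d * (Q * s))%N.
  rewrite size_boxcell -(size_box F W) -sum1_size big_distrl /= big_seq [leqRHS]big_seq.
  by apply: leq_sum => k kb; rewrite mul1n; exact: (near W k (leqnn _) kb).1.
have wW : (w <= W)%N by rewrite /W; nia.
have lo : ((w.*2.+1) ^ d * s <= Q * size (boxcell n F w))%N.
  rewrite size_boxcell -(size_box F w) -sum1_size big_distrl big_distrr /= big_seq [leqRHS]big_seq.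
  by apply: leq_sum => k kb; rewrite mul1n; exact: (near w k wW kb).2.
apply: leq_trans up _.
have hW : (W.*2.+1 <= (8 * D + 5) * w.*2.+1)%N by rewrite /W -!addnn; nia.
apply: (@leq_trans (((8 * D + 5) * w.*2.+1) ^ d * (Q * s))).
  by rewrite leq_mul2r leq_exp2r // hW orbT.
rewrite expnMn -mulnn -!mulnA leq_mul2l; apply/orP; right.
by rewrite mulnCA leq_mul2l lo orbT.
Qed.

Variable g : 'rV[R]_d -> 'rV[R]_d.
Hypotheses (giso : Defs.isometry g) (gsurj : forall x, exists y, g y = x).
Variable nu : {measure set (borelRV R d) -> \bar R}.
Hypothesis nuE : forall A, nu A = leb ((g \o cod) @^-1` A).

Lemma doubling_coding : doubling nu.
Proof.
have Dp : 0 < D%:R :> R by rewrite ltr0n.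
have isoE t y : enorm (g (cod t) - g y) = enorm (cod t - y) by exact: giso.
split.
- rewrite gt_eqF // nuE preimage_setT.
  apply: (@lt_le_trans _ _ 1%E); first exact: lte01.
  apply: le_trans (le_lebesgue (subsetT [set t : R | Num.floor t = 0])).
  by rewrite floor0_itv lebesgue_measure_itv /= lte_fin ltr01 -EFinD subr0.
- move=> x; exists (ball x 1 : set 'rV[R]_d); split.
    by split; [exact: ball_open | exact: ballxx].
  have [y yx] := gsurj x; rewrite nuE.
  apply: le_lt_trans (boxcell_upper leL eK e'K (n := 0) (y := y) (w := D.+1) (c := D%:R) _ _) _.
  + move=> t [_ /= xt] j; have -> : cod t 0 j - y 0 j = (cod t - y) 0 j by rewrite !mxE.
    apply: le_trans (abs_le_enorm _ _) _; rewrite -isoE yx ltW //.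
    apply: enorm_lt => // i; rewrite divff ?gt_eqF // ltW //.
    by have := xt 0 i; rewrite /ball /= distrC !mxE.
  + by rewrite expr0 mulr1 natr1.
  + exact: ltry.
exists ((8 * D + 5) ^ d * (L ^ (2 * D * N.+1 + 1)) ^ 2)%:R; split.
  rewrite ltr1n; apply: (@leq_trans ((8 * D + 5) ^ d)).
    by case: d d_gt0 => // d' _; rewrite expnS; have := expn_gt0 (8 * d'.+2 + 5) d'; nia.
  by rewrite leq_pmulr // !expn_gt0 L_gt0.
move=> x r r0; have [y <-] := gsurj x; rewrite !nuE.
have [n [w [w1 w2 hn]]] := ex_scale (isT : (1 < N)%N) (ltn0Sn d) r0.
have Nn := Nexp_gt0 R N0 n.
have Ln : 0 < L%:R ^+ n :> R by rewrite exprn_gt0 // ltr0n L_gt0.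
apply: le_trans (boxcell_upper leL eK e'K (n := n) (y := y) (w := (2 * D * w.+2 + 1)%N) (c := 2 * r) _ _) _.
- move=> t; rewrite /eball /= isoE => h j.
  have -> : cod t 0 j - y 0 j = (cod t - y) 0 j by rewrite !mxE.
  by apply: le_trans (abs_le_enorm _ _) _; exact: ltW.
- by rewrite natrD lerD2r -mulrA -mulnA natrM ler_pM2l.
apply: le_trans (lee_wpmul2l _ (boxcell_lower leL eK e'K (n := n) (y := y) (w := w) _)).
- rewrite -EFinM lee_fin mulrA ler_pM2r ?invr_gt0 // -natrM ler_nat.
  exact: size_boxcell_comparable.
- by rewrite lee_fin.
- move=> t h; rewrite /eball /= isoE; apply: enorm_lt => // j.
  have -> : (cod t - y) 0 j = cod t 0 j - y 0 j by rewrite !mxE.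
  rewrite ler_pdivlMr // -(ler_pM2r Nn) mulrAC; apply: le_trans w1.
  by rewrite natrM [D%:R * _]mulrC ler_pM2r //; exact: h.
Qed.

End DoublingCoding.

(** * Good points and slopes *)

Lemma lebesgue_uncovered_gt0 (R : realType) (U : set R) (F : nat -> set R) :
  measurable (U : set (measurableTypeR R)) -> lebesgue_measure U = 1%E ->
  (forall n, measurable (F n : set (measurableTypeR R))) ->
  (forall n, (lebesgue_measure (F n) <= (2^-1 / (2 ^ n.+1)%:R)%:E)%E) ->
  (0 < lebesgue_measure (U `\` \bigcup_n F n))%E.
Proof.
move=> mU U1 mF hF; set V := \bigcup_n F n.
have mV : measurable (V : set (measurableTypeR R)) by exact: bigcupT_measurable.
have half0 : 0 <= 2^-1 :> R by rewrite invr_ge0.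
have V2 : (lebesgue_measure V <= (2^-1)%:E)%E.
  apply: le_trans (epsilon_trick0 xpredT half0).
  apply: (@le_trans _ _ (\sum_(0 <= n <oo) lebesgue_measure (F n))%E).
    by apply: (@measure_sigma_subadditive _ _ _ (@lebesgue_measure R) V F) => //; exact: mF.
  by apply: lee_nneseries => // n _; exact: hF.
rewrite ltNge; apply/negP => UV0.
have : (1 <= (2^-1 : R)%:E)%E.
  rewrite -U1; apply: (@le_trans _ _ (lebesgue_measure ((U `\` V) `|` V))).
    by apply: le_lebesgue => t Ut; have [|] := pselect (V t); [right|left].
  have mUV : measurable (U `\` V : set (measurableTypeR R)) by exact: measurableD.
  apply: le_trans (@measureU2 _ _ _ (@lebesgue_measure R) _ _ mUV mV) _.
  by rewrite -[leRHS]add0e; exact: leeD.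
by rewrite lee_fin; lra.
Qed.

Lemma lebesgue_nonempty (R : realType) (U : set R) (F : nat -> set R) :
  measurable (U : set (measurableTypeR R)) -> lebesgue_measure U = 1%E ->
  (forall n, measurable (F n : set (measurableTypeR R))) ->
  (forall n, (lebesgue_measure (F n) <= (2^-1 / (2 ^ n.+1)%:R)%:E)%E) ->
  U `\` \bigcup_n F n !=set0.
Proof.
move=> mU U1 mF hF; have := lebesgue_uncovered_gt0 mU U1 mF hF.
by apply: contraPP => /set0P/negP; rewrite negbK => /eqP ->; rewrite measure0 ltxx.
Qed.

Lemma lebesgue_union_seq (R : realType) (I : Type) (s : seq I) (A : I -> set R) (c : R) :
  0 <= c -> (forall i, measurable (A i : set (measurableTypeR R))) ->
  (forall i, (lebesgue_measure (A i) <= c%:E)%E) ->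
  measurable (\big[setU/set0]_(i <- s) A i : set (measurableTypeR R)) /\
  (lebesgue_measure (\big[setU/set0]_(i <- s) A i) <= ((size s)%:R * c)%:E)%E.
Proof.
move=> c0 mA hA; elim: s => [|i s [IHm IH]].
  by rewrite big_nil measure0 mul0r; split => //; exact: measurable0.
rewrite big_cons; split; first exact: measurableU.
apply: le_trans (@measureU2 _ _ _ (@lebesgue_measure R) _ _ (mA i) IHm) _.
by rewrite /= -natr1 mulrDl mul1r addrC EFinD; exact: leeD.
Qed.

Section GoodPoints.
Variables (R : realType) (d N0 L s : nat).
Local Notation N := N0.+3.
Hypothesis hL : (N ^ d * 8 ^ s <= L)%N.
Local Notation leb := (@lebesgue_measure R).
Local Notation codept := (@codept R d N0 L).

Lemma leL_of_hL : (N ^ d <= L)%N.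
Proof. by rewrite (leq_trans _ hL) // leq_pmulr // expn_gt0. Qed.
Let leL := leL_of_hL.
Let L_gt0 : (0 < L)%N := L_gt0 leL.

Definition good : set R := [set t | Num.floor t = 0] `\`
  \bigcup_n [set t | level L n.+1 t \in bad_words d N0 L s n.+1].

Lemma good_gt0 : (0 < leb good)%E.
Proof.
apply: lebesgue_uncovered_gt0.
- by rewrite floor0_itv; exact: measurable_itv.
- by rewrite floor0_itv lebesgue_measure_itv /= lte_fin ltr01 -EFinD subr0.
- by move=> n; exact: (measurable_level_preimage L_gt0 n.+1 (fun m => m \in bad_words d N0 L s n.+1)).
move=> n; apply: le_trans (lebesgue_level_le R L_gt0 _ _) _.
rewrite lee_fin ler_pdivrMr ?exprn_gt0 ?ltr0n //.
have := size_bad_words leL n.+1 hL; rewrite -(ler_nat R) natrM => h.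
rewrite -natrX; apply: (@le_trans _ _ ((L ^ n.+1)%:R / (4 ^ n.+1)%:R)).
  by rewrite ler_pdivlMr // ltr0n expn_gt0.
rewrite mulrC ler_pM2r ?ltr0n ?expn_gt0 ?L_gt0 //.
rewrite -invfM lef_pV2 ?posrE ?ltr0n ?expn_gt0 ?mulr_gt0 ?ltr0n ?expn_gt0 //.
rewrite -natrM ler_nat -expnS -[4%N]/(2 ^ 2)%N -expnM leq_exp2l //; lia.
Qed.

Lemma good_floor t : good t -> Num.floor t = 0.
Proof. by case. Qed.

Lemma good_sparse t n : good t ->
  cell0 N L (kap d N0) n (level L n t) \in sparse_cells d N0 s n.
Proof.
move=> [t0 tb]; apply/mapP; exists (cell0 N L (kap d N0) n (level L n t), ncount d N0 L n (level L n t)) => //.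
rewrite mem_filter mem_cells andbT /= leqNgt; apply/negP => h.
case: n h => [|n] h; first by rewrite /= muln0 in h.
apply: tb; exists n; rewrite // /mkset mem_filter h andTb.
apply: (mem_words leL).
have E := divz_eq (level L n.+1 t) (L ^ n.+1)%N.
rewrite (level_floor leL) in E.
have Ln : (L ^ n.+1)%N%:Z != 0 by rewrite -lt0n expn_gt0 L_gt0.
by rewrite E t0 mul0r add0r modz_ge0 // ltz_pmod // ltz_nat expn_gt0 L_gt0.
Qed.

Variables (b nu : R).
Hypotheses (b1 : 1 <= b) (hb : (N ^ d)%:R <= b ^+ s).
Hypotheses (nu0 : 0 < nu) (nu1 : nu < 1) (hnu : 512 * b ^+ 2 <= N%:R * nu).

(* For [|c|] not too small, the slopes [theta] with [|a + theta * c| < 3 / N ^ n]. *)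
Definition bad_slopes (i0 i1 : 'I_d) n (p : 'rV[int]_d * 'rV[int]_d) : set R :=
  let a := (p.1 0 i0 - p.2 0 i0)%:~R / N%:R ^+ n in
  let c := (p.1 0 i1 - p.2 0 i1)%:~R / N%:R ^+ n in
  if nu ^+ n / 4 <= `|c| then ball (- a / c) (3 * (N%:R ^+ n)^-1 / `|c|) else set0.

Lemma ex_slope (i0 i1 : 'I_d) : exists theta : R, 0 <= theta <= 1 /\
  forall n p, p.1 \in sparse_cells d N0 s n.+1 -> p.2 \in sparse_cells d N0 s n.+1 ->
    ~ bad_slopes i0 i1 n.+1 p theta.
Proof.
pose ps n := [seq (k, k') | k <- sparse_cells d N0 s n.+1, k' <- sparse_cells d N0 s n.+1].
pose F n := \big[setU/set0]_(p <- ps n) bad_slopes i0 i1 n.+1 p.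
have Np : 0 < N%:R :> R by rewrite ltr0n.
pose c n : R := 24 * ((N%:R ^+ n.+1)^-1 / nu ^+ n.+1).
have c0 n : 0 <= c n.
  by rewrite mulr_ge0 // ltW // divr_gt0 ?exprn_gt0 // invr_gt0 Nexp_gt0.
have mb n p : measurable (bad_slopes i0 i1 n.+1 p : set (measurableTypeR R)).
  by rewrite /bad_slopes; case: ifP => _; [rewrite ball_itv; exact: measurable_itv | exact: measurable0].
have lb n p : (leb (bad_slopes i0 i1 n.+1 p) <= (c n)%:E)%E.
  rewrite /bad_slopes; set y := (p.1 0 i1 - p.2 0 i1)%:~R / N%:R ^+ n.+1.
  case: ifP => [h|_]; last by rewrite measure0 lee_fin.
  have y0 : 0 < `|y| by apply: lt_le_trans h; rewrite divr_gt0 // exprn_gt0.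
  have Nn := Nexp_gt0 R N0 n.+1.
  have nn : 0 < nu ^+ n.+1 by rewrite exprn_gt0.
  rewrite lebesgue_measure_ball; last by rewrite divr_ge0 // mulr_ge0 // invr_ge0 ltW.
  have Ni : 0 < (N%:R ^+ n.+1 : R)^-1 by rewrite invr_gt0.
  rewrite lee_fin /c; move: (N%:R ^+ n.+1)^-1 Ni (nu ^+ n.+1) nn (`|y|) h y0 => M M0 v v0 z h z0.
  have -> : 3 * M / z *+ 2 = 6 * M / z by rewrite -mulr_natr; ring.
  rewrite ler_pdivrMr // (_ : 24 * (M / v) * z = 24 * M * z / v); last by ring.
  have : 0 <= M * (z - v / 4) by apply: mulr_ge0; [exact: ltW | rewrite subr_ge0].
  by rewrite ler_pdivlMr //; lra.
have mF n : measurable (F n : set (measurableTypeR R)) /\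
    (leb (F n) <= ((size (ps n))%:R * c n)%:E)%E.
  by apply: lebesgue_union_seq.
have [|||n|theta [/= th01 thF]] := @lebesgue_nonempty R `[0, 1]%classic F.
- exact: measurable_itv.
- by rewrite lebesgue_measure_itv /= lte_fin ltr01 -EFinD subr0.
- by move=> n; exact: (mF n).1.
- apply: le_trans (mF n).2 _; rewrite lee_fin size_allpairs natrM.
  set S := (size _)%:R : R.
  have hS : S <= (2 * b) ^+ n.+1 by exact: size_sparse_cells.
  have S0 : 0 <= S by rewrite ler0n.
  have b0 : 0 < b by rewrite (lt_le_trans _ b1).
  have nn : 0 < nu ^+ n.+1 by rewrite exprn_gt0.
  have Nn := Nexp_gt0 R N0 n.+1.
  apply: (@le_trans _ _ ((2 * b) ^+ n.+1 * (2 * b) ^+ n.+1 * c n)).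
    by rewrite ler_wpM2r // ler_pM.
  rewrite /c -invfM -!exprMn (_ : 2 * b * (2 * b) = 4 * b ^+ 2); last by ring.
  rewrite mulrCA -expr_div_n.
  have q1 : 0 <= 4 * b ^+ 2 / (N%:R * nu) <= 128^-1.
    have Nnu : 0 < N%:R * nu by rewrite mulr_gt0.
    apply/andP; split; first by apply: divr_ge0; [apply: mulr_ge0; [rewrite ler0n | exact: sqr_ge0] | exact: ltW].
    by rewrite ler_pdivrMr //; move: hnu; lra.
  have {q1}h : (4 * b ^+ 2 / (N%:R * nu)) ^+ n.+1 <= (128^-1) ^+ n.+1.
    by rewrite lerXn2r ?nnegrE ?invr_ge0 //; case/andP: q1.
  apply: (@le_trans _ _ (24 * (128^-1) ^+ n.+1)); first by rewrite ler_pM2l.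
  rewrite natrX -exprVn (_ : 128^-1 = 64^-1 * 2^-1 :> R); last by rewrite -invfM -natrM.
  rewrite exprMn mulrA ler_pM2r ?exprn_gt0 ?invr_gt0 //.
  have : (64^-1 : R) ^+ n.+1 <= 64^-1 by rewrite exprS ger_pMr ?invr_gt0 // exprn_ile1 // ?invr_ge0 // invf_le1 // ler1n.
  by lra.
exists theta; split; first by move: th01; rewrite in_itv.
move=> n [k k'] /= hk hk' hth; apply: thF; exists n => //.
rewrite /F -bigcup_seq; exists (k, k') => //=.
by apply/allpairsP; exists (k, k').
Qed.

Lemma good_separated (i0 i1 : 'I_d) (theta : R) : 0 <= theta <= 1 ->
  (forall n p, p.1 \in sparse_cells d N0 s n.+1 -> p.2 \in sparse_cells d N0 s n.+1 ->
    ~ bad_slopes i0 i1 n.+1 p theta) ->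
  forall t t', good t -> good t' ->
  let u j := codept t 0 j - codept t' 0 j in
  let M := Num.max `|u i0| `|u i1| in
  M = 0 \/ exists n, M <= nu ^+ n /\ (N%:R ^+ n.+1)^-1 <= `|u i0 + theta * u i1|.
Proof.
move=> /andP[th0 th1] hth t t' gt gt' u M.
have [M0|M0] := eqVneq M 0; [by left | right].
have {}M0 : 0 < M by rewrite lt_def M0 /= le_max normr_ge0.
have u1 j : `|u j| <= 1.
  have /andP[? ?] := codept01 leL t j; have /andP[? ?] := codept01 leL t' j.
  by rewrite ler_norml /u; apply/andP; split; lra.
have M1 : M <= 1 by rewrite ge_max !u1.
have ex : exists n, nu ^+ n.+1 <= M.
  have : (GRing.exp nu @ \oo --> (0 : R)) by apply: cvg_expr; rewrite gtr0_norm.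
  move=> /cvgrPdist_lt /(_ _ M0) [n _ /(_ n.+1 (leqnSn n))] /=.
  by rewrite sub0r normrN ger0_norm ?exprn_ge0 ?(ltW nu0) // => /ltW h; exists n.
case: (ex_minnP ex) => n nM nmin.
exists n; split.
  case: n nM nmin => [|n] nM nmin; first by rewrite expr0.
  by apply: ltW; rewrite ltNge; apply/negP => /nmin; rewrite ltnn.
rewrite leNgt; apply/negP => small.
have gs := good_sparse n.+1 gt; have gs' := good_sparse n.+1 gt'.
have := hth n (_, _) gs gs'; apply; rewrite /bad_slopes.
set k := cell0 _ _ _ _ _; set k' := cell0 _ _ _ _ _.
cbn [fst snd].
set a := (k 0 i0 - k' 0 i0)%:~R / _; set c := (k 0 i1 - k' 0 i1)%:~R / _.
set x := (N%:R ^+ n.+1 : R)^-1 in small *; set v := nu ^+ n.+1 in nM *.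
have v0 : 0 < v by rewrite exprn_gt0.
have x0 : 0 < x by rewrite invr_gt0 Nexp_gt0.
have xv : 512 * x <= v.
  rewrite -ler_pdivlMr ?invr_gt0 // /x invrK mulrC.
  rewrite /v -exprMn; apply: (@le_trans _ _ (N%:R * nu)).
    apply: le_trans hnu; rewrite ler_peMr // expr_ge1 //; exact: le_trans b1.
  rewrite exprS ler_peMr ?mulr_ge0 ?(ltW nu0) // exprn_ege1 //.
  by apply: le_trans hnu; have := b1; nra.
have near j : `|u j - (k 0 j - k' 0 j)%:~R * x| <= x.
  have /andP[h1 h2] : (k 0 j)%:~R * x <= codept t 0 j <= (k 0 j)%:~R * x + x :=
    coding_bounds leL (fun=> 0) n.+1 t j.
  have /andP[h3 h4] : (k' 0 j)%:~R * x <= codept t' 0 j <= (k' 0 j)%:~R * x + x :=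
    coding_bounds leL (fun=> 0) n.+1 t' j.
  rewrite intrB mulrBl /u; move: h1 h2 h3 h4.
  move: (codept t 0 j) (codept t' 0 j) (_ * x) (_ * x) => p q r r' *.
  by rewrite ler_norml; apply/andP; split; lra.
have na : `|u i0 - a| <= x := near i0.
have nc : `|u i1 - c| <= x := near i1.
have hM : `|u i1| >= M / 2.
  rewrite leNgt; apply/negP => h.
  have [E|E] : M = `|u i0| \/ M = `|u i1| by rewrite /M maxEle; case: ifP; [right|left].
    have h2 : `|theta * u i1| <= `|u i1| by rewrite normrM ger0_norm // ler_piMl.
    have h3 := lerB_normD (u i0) (theta * u i1).
    move: h2 h3 small h nM xv; rewrite E.
    move: (`|u i0|) (`|theta * u i1|) (`|u i1|) (`|u i0 + theta * u i1|) => p q r w.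
    lra.
  move: h M0; rewrite E; move: (`|u i1|) => p; lra.
have hc : v / 4 <= `|c|.
  have := ler_normD (u i1 - c) c; rewrite subrK.
  by move: hM nM nc xv; lra.
rewrite hc.
have c0 : 0 < `|c| by apply: lt_le_trans hc; rewrite divr_gt0.
rewrite /ball /= ltr_pdivlMr // -normrM mulrBl -mulrA mulVf -?normr_gt0 // mulr1.
have htn : `|theta * (u i1 - c)| <= x.
  by rewrite normrM ger0_norm //; apply: le_trans nc; rewrite ler_piMl.
have -> : - a - theta * c = (u i0 - a) + theta * (u i1 - c) - (u i0 + theta * u i1) by ring.
apply: le_lt_trans (ler_normB _ _) _.
have := ler_normD (u i0 - a) (theta * (u i1 - c)).
by move: htn na small; lra.
Qed.

End GoodPoints.

(** * Extension and rotation *)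

Lemma powR_subadditive (R : realType) (gamma a b : R) : 0 < gamma -> gamma <= 1 ->
  0 <= a -> 0 <= b -> (a + b) `^ gamma <= a `^ gamma + b `^ gamma.
Proof.
move=> g0 g1 a0 b0; have [ab0|] := ltP 0 (a + b); last first.
  move=> ab; have -> : a = 0 by lra.
  by rewrite add0r lerDr powR_ge0.
have share x : 0 <= x -> x <= a + b -> x / (a + b) * (a + b) `^ gamma <= x `^ gamma.
  move=> x0 xab; have q0 : 0 <= x / (a + b) by rewrite divr_ge0 // ltW.
  have -> : x `^ gamma = (x / (a + b)) `^ gamma * (a + b) `^ gamma.
    by rewrite -powRM ?divfK ?gt_eqF // ltW.
  rewrite ler_wpM2r ?powR_ge0 //.
  have [->|xn0] := eqVneq x 0; first by rewrite mul0r powR_ge0.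
  have xp : 0 < x by rewrite lt_def xn0.
  by apply: ger1_powR => //; rewrite divr_gt0 //= ler_pdivrMr // mul1r.
have h1 : a / (a + b) * (a + b) `^ gamma <= a `^ gamma by apply: share => //; lra.
have h2 : b / (a + b) * (a + b) `^ gamma <= b `^ gamma by apply: share => //; lra.
have E : a / (a + b) * (a + b) `^ gamma + b / (a + b) * (a + b) `^ gamma = (a + b) `^ gamma.
  by rewrite -!mulrDl divff ?mul1r // gt_eqF.
by rewrite -[leLHS]E lerD.
Qed.

(* McShane: [inf_t h t + C |y - p t|^gamma] extends [h]. *)
Lemma hoelder_extension (R : realType) (V : normedModType R) (T : Type) (A : set T)
    (p : T -> V) (h : T -> R) (C gamma : R) :
  0 < gamma -> gamma <= 1 -> 0 <= C -> A !=set0 ->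
  (forall t t', A t -> A t' -> `|h t - h t'| <= C * `|p t - p t'| `^ gamma) ->
  exists f : V -> R, (forall t, A t -> f (p t) = h t) /\
    forall y y', `|f y - f y'| <= C * `|y - y'| `^ gamma.
Proof.
move=> g0 g1 C0 [t0 At0] hp.
pose E y := [set h t + C * `|y - p t| `^ gamma | t in A].
have tri (y y' z : V) : C * `|y - z| `^ gamma <= C * `|y - y'| `^ gamma + C * `|y' - z| `^ gamma.
  rewrite -mulrDr ler_wpM2l // (le_trans _ (powR_subadditive g0 g1 (normr_ge0 _) (normr_ge0 _))) //.
  by rewrite ge0_ler_powR ?nnegrE ?(ltW g0) ?addr_ge0 // ler_distD.
have lbE y t : A t -> lbound (E y) (h t - C * `|y - p t| `^ gamma).
  move=> At _ [t' At' <-]; have := hp t t' At At'; have := tri (p t) y (p t').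
  by rewrite [`|p t - y|]distrC ler_norml => H /andP[_ H2]; lra.
have E0 y : E y !=set0 by exists (h t0 + C * `|y - p t0| `^ gamma), t0.
have hlb y : has_lbound (E y) by exists (h t0 - C * `|y - p t0| `^ gamma); exact: lbE.
exists (fun y => inf (E y)); split => [t At|].
  apply/eqP; rewrite eq_le; apply/andP; split.
    by apply: ge_inf => //; exists t => //; rewrite subrr normr0 powR0 ?gt_eqF // mulr0 addr0.
  apply: lb_le_inf => //; have := lbE (p t) t At.
  by rewrite subrr normr0 powR0 ?gt_eqF // mulr0 subr0.
have half y y' : inf (E y) - inf (E y') <= C * `|y - y'| `^ gamma.
  rewrite lerBlDl -lerBlDr; apply: lb_le_inf => // _ [t At <-].
  rewrite lerBlDr; apply: (@le_trans _ _ (h t + C * `|y - p t| `^ gamma)).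
    by apply: ge_inf => //; exists t.
  by have := tri y y' (p t); lra.
move=> y y'; rewrite ler_norml half andbT lerNl opprB distrC; exact: half.
Qed.

Lemma isometry_continuous (R : realType) d (g : 'rV[R]_d -> 'rV[R]_d) :
  Defs.isometry g -> continuous g.
Proof.
move=> giso x U /= /nbhs_ballP[eps /= e0 sub].
have r0 : 0 < eps / d.+1%:R by rewrite divr_gt0 // ltr0n.
apply/nbhs_ballP; exists (eps / d.+1%:R) => //= y [_ xy]; apply: sub; split => // i j.
rewrite ord1 /ball /= -[ltLHS]/(`|g x 0 j - g y 0 j|).
have -> : g x 0 j - g y 0 j = (g x - g y) 0 j by rewrite !mxE.
apply: le_lt_trans (abs_le_enorm _ _) _; rewrite giso; apply: enorm_lt => // k.
by have := xy 0 k; rewrite /ball /= !mxE => /ltW.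
Qed.

Section Rotation.
Variables (R : realType) (d : nat) (i0 i1 : 'I_d).
Hypothesis i01 : i0 != i1.

Definition rotation (c s : R) (x : 'rV[R]_d) : 'rV[R]_d :=
  \row_j if j == i0 then c * x 0 i0 + s * x 0 i1
         else if j == i1 then - s * x 0 i0 + c * x 0 i1 else x 0 j.

Lemma rotation0 c s x : rotation c s x 0 i0 = c * x 0 i0 + s * x 0 i1.
Proof. by rewrite mxE eqxx. Qed.

Lemma rotation1 c s x : rotation c s x 0 i1 = - s * x 0 i0 + c * x 0 i1.
Proof. by rewrite mxE eq_sym (negbTE i01) eqxx. Qed.

Lemma rotationB c s x y : rotation c s x - rotation c s y = rotation c s (x - y).
Proof. by apply/rowP => j; rewrite !mxE; case: ifP => _; [ring | case: ifP => _ //; ring]. Qed.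

Lemma rotation_isometry c s : c ^+ 2 + s ^+ 2 = 1 -> Defs.isometry (rotation c s).
Proof.
move=> cs x y; rewrite rotationB; set z := x - y; rewrite /enorm; congr Num.sqrt.
rewrite (bigD1 i0) //= [in RHS](bigD1 i0) //= (bigD1 i1) 1?eq_sym //= [in RHS](bigD1 i1) 1?eq_sym //=.
rewrite rotation0 rotation1 !addrA; congr (_ + _).
  move: (z 0 i0) (z 0 i1) => a b.
  rewrite -[RHS]mul1r -cs; ring.
by apply: eq_bigr => j /andP[/negbTE j0 /negbTE j1]; rewrite mxE j0 j1.
Qed.

Lemma rotationK c s : c ^+ 2 + s ^+ 2 = 1 -> cancel (rotation c (- s)) (rotation c s).
Proof.
move=> cs x; apply/rowP => j; rewrite mxE rotation0 rotation1 mxE.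
have [->|_] := eqVneq j i0; first by rewrite -[RHS]mul1r -cs; ring.
by have [->|_] := eqVneq j i1; first by rewrite -[RHS]mul1r -cs; ring.
Qed.

End Rotation.

Lemma ex_parameters (R : realType) (d : nat) (gamma : R) : 0 < gamma -> gamma < 1 ->
  exists (N0 s : nat) (b : R), let nu := N0.+3%:R `^ (- gamma) in
  [/\ 1 <= b, (N0.+3 ^ d)%:R <= b ^+ s, 0 < nu, nu < 1 & 512 * b ^+ 2 <= N0.+3%:R * nu].
Proof.
move=> g0 g1; have g1' : 0 < 1 - gamma by rewrite subr_gt0.
pose al := (1 - gamma) / 4; have al0 : 0 < al by rewrite divr_gt0.
pose N0 := Num.trunc ((512 : R) `^ (2 * al)^-1); set N := N0.+3.
pose s := (Num.trunc (d%:R / al)).+1.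
have N1 : 1 <= N%:R :> R by rewrite ler1n.
have Np : 0 < N%:R :> R by rewrite ltr0n.
have NN : (512 : R) `^ (2 * al)^-1 <= N%:R.
  apply: ltW; apply: lt_le_trans (truncnS_gt _) _; by rewrite ler_nat ltnS leqW.
have Nal : 512 <= (N%:R : R) `^ (2 * al).
  have al2 : 0 <= 2 * al by rewrite mulr_ge0 // ltW.
  have -> : (512 : R) = (512 `^ (2 * al)^-1) `^ (2 * al).
    by rewrite -powRrM mulVf ?powRr1 // gt_eqF // mulr_gt0.
  by rewrite ge0_ler_powR ?nnegrE ?powR_ge0.
exists N0, s, (N%:R `^ al); rewrite -/N; split.
- by have := ler_powR N1 (ltW al0); rewrite powRr0.
- rewrite -powR_mulrn ?powR_ge0 // -powRrM natrX -powR_mulrn // ler_powR //.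
  by rewrite mulrC -ler_pdivrMr // ltW // truncnS_gt.
- by rewrite powR_gt0.
- rewrite powRN invf_lt1 ?powR_gt0 // ltNge; apply/negP => h.
  have : (N%:R `^ gamma) `^ gamma^-1 <= (1 : R) `^ gamma^-1.
    by rewrite ge0_ler_powR ?nnegrE ?powR_ge0 // invr_ge0 ltW.
  rewrite -powRrM mulfV ?gt_eqF // powRr1 ?(ltW Np) // powR1 => h1.
  have : (1 : R) < N%:R by rewrite ltr1n.
  by rewrite ltNge h1.
- rewrite -powR_mulrn ?powR_ge0 // -powRrM.
  have -> : N%:R * N%:R `^ (- gamma) = N%:R `^ (2 * al) * N%:R `^ (2 * al) :> R.
    rewrite -powRD; last by rewrite (gt_eqF Np) implybT.
    rewrite -{1}[N%:R](powRr1 (ltW Np)) -powRD; last by rewrite (gt_eqF Np) implybT.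
    by congr (_ `^ _); rewrite /al; field.
  by rewrite [al * _]mulrC ler_pM2r // powR_gt0.
Qed.

Lemma powR_expV (R : realType) (N n : nat) (gamma : R) : (0 < N)%N ->
  (N%:R `^ (- gamma)) ^+ n = (N%:R ^+ n)^-1 `^ gamma.
Proof.
move=> N0; have Np : 0 < N%:R ^+ n :> R by rewrite exprn_gt0 // ltr0n.
rewrite -powR_mulrn ?powR_ge0 // -powRrM mulrC mulrN powRN powRrM powR_mulrn ?ler0n //.
by rewrite -(powR_inv1 (ltW Np)) -powRrM mulN1r powRN.
Qed.

Lemma rV_coord_le (R : realType) n (x : 'rV[R]_n) j : `|x 0 j| <= `|x|.
Proof. by rewrite [leRHS]/Num.Def.normr /= mx_normrE; apply/bigmax_geP; right; exists (0, j). Qed.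

Lemma graph_pointE (R : realType) d (f : 'rV[R]_d.+1 -> R) (z : 'rV[R]_d.+2) :
  f (\row_j z 0 (widen_ord (leqnSn _) j)) = z 0 ord_max ->
  @graph_point R d.+2 f (\row_j z 0 (widen_ord (leqnSn _) j)) = z.
Proof.
move=> fz; apply/rowP => j; rewrite mxE; case: insubP => [i _ ij|].
  by rewrite mxE; congr (z 0 _); apply: val_inj.
rewrite -leqNgt => jd; rewrite fz; congr (z 0 _); apply: val_inj => /=.
by apply/eqP; rewrite eqn_leq jd -ltnS ltn_ord.
Qed.

Theorem corollary4p2 (R : realType) (d : nat) (gamma : R)
    (hd : (2 <= d)%N) (gamma_gt0 : 0 < gamma) (gamma_lt1 : gamma < 1) :
  exists (f : 'rV[R]_d.-1 -> R) (nu : {measure set (borelRV R d) -> \bar R}),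
    [/\ hoelder_continuous gamma f, self_similar_measure nu, doubling nu &
        (0 < nu (graph_of f))%E].
Proof.
have [N0 [s [b [b1 hb v0 v1 hv]]]] := ex_parameters d gamma_gt0 gamma_lt1.
case: d hd hb => [//|[//|d]] _ hb.
set N := N0.+3 in hb v0 v1 hv *; pose L := (N ^ d.+2 * 8 ^ s)%N.
have hL : (N ^ d.+2 * 8 ^ s <= L)%N by [].
have leL : (N ^ d.+2 <= L)%N := leL_of_hL hL.
pose i0 : 'I_d.+2 := ord0; pose i1 : 'I_d.+2 := ord_max.
have i01 : i0 != i1 by [].
have [theta [th01 slope]] := ex_slope b1 hb v0 hv i0 i1.
pose q := Num.sqrt (1 + theta ^+ 2).
have q0 : 0 < q by rewrite sqrtr_gt0 ltr_pwDl // sqr_ge0.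
have q2 : q ^+ 2 = 1 + theta ^+ 2 by rewrite sqr_sqrtr // addr_ge0 // sqr_ge0.
have qle2 : q <= 2.
  by rewrite -(ler_pXn2r (n := 2)) ?nnegrE ?(ltW q0) // q2; move/andP: th01 => [? ?]; nra.
pose c := q^-1; pose sn := theta / q.
have cs : c ^+ 2 + sn ^+ 2 = 1.
  by rewrite /c /sn exprVn expr_div_n q2 -{1}[_^-1]mul1r -mulrDl divff // -q2 gt_eqF // exprn_gt0.
have c1 : `|c| <= 1 /\ `|sn| <= 1.
  by split; rewrite -(ler_pXn2r (n := 2)) ?nnegrE // real_normK ?num_real // expr1n -cs ?lerDl ?lerDr sqr_ge0.
pose g := rotation i0 i1 c sn.
have giso : Defs.isometry g by exact: rotation_isometry.
have gsurj x : exists y, g y = x.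
  by exists (rotation i0 i1 c (- sn) x); exact: rotationK.
have [e [e' eK e'K]] := @ex_lattice_enumeration d.+2 isT.
pose cod := @coding R d.+2 N0 L e.
have mgc := measurable_coding leL e (isometry_continuous giso).
have [nu nuE] := ex_pushforward (@lebesgue_measure R) mgc.
pose G := @good R d.+2 N0 L s.
have Ggt0 : (0 < lebesgue_measure G)%E := good_gt0 R hL.
have Gn0 : G !=set0.
  by apply/set0P/eqP => G0; rewrite G0 measure0 ltxx in Ggt0.
pose z t := g (cod t).
pose p t : 'rV[R]_d.+1 := \row_j z t 0 (widen_ord (leqnSn _) j).
pose h t := z t 0 i1.
pose C : R := 2 * (2 * N%:R) `^ gamma.
have C0 : 0 <= C by rewrite mulr_ge0 // powR_ge0.
have hol t t' : G t -> G t' -> `|h t - h t'| <= C * `|p t - p t'| `^ gamma.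
  move=> Gt Gt'.
  pose u j := codept d.+2 N0 L t 0 j - codept d.+2 N0 L t' 0 j.
  have uE j : (cod t - cod t') 0 j = u j.
    have E r : Num.floor r = 0 -> cod r 0 j = codept d.+2 N0 L r 0 j + (e 0 0 j)%:~R.
      by move=> r0; rewrite /cod (codingE leL) r0 mxE [X in _ + X]mxE.
    by rewrite mxE [X in _ + X]mxE (E _ (good_floor Gt)) (E _ (good_floor Gt')) opprD addrACA subrr addr0.
  have zE j : z t 0 j - z t' 0 j = g (cod t - cod t') 0 j.
    by rewrite /g -rotationB [RHS]mxE [X in _ = _ + X]mxE.
  pose M := Num.max `|u i0| `|u i1|.
  have hM : `|h t - h t'| <= 2 * M.
    rewrite /h zE rotation1 // !uE (le_trans (ler_normD _ _)) // !normrM normrN mulr2n mulrDl !mul1r.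
    rewrite lerD // -[leRHS]mul1r ler_pM ?c1.1 ?c1.2 //; by rewrite le_max lexx ?orbT.
  have hw : `|u i0 + theta * u i1| <= 2 * `|p t - p t'|.
    have -> : u i0 + theta * u i1 = q * (z t 0 i0 - z t' 0 i0).
      by rewrite zE rotation0 !uE /c /sn; field; rewrite gt_eqF.
    have -> : z t 0 i0 - z t' 0 i0 = (p t - p t') 0 0.
      have pE r : p r 0 0 = z r 0 i0 by rewrite /p mxE; congr (z r 0 _); apply: val_inj.
      by rewrite [RHS]mxE [X in _ = _ + X]mxE !pE.
    by rewrite normrM ler_pM ?rV_coord_le // gtr0_norm.
  apply: le_trans hM _; rewrite /C -mulrA ler_pM2l // -powRM ?mulr_ge0 //.
  have [->|[n [Mn nw]]] : M = 0 \/ exists n, M <= (N%:R `^ (- gamma)) ^+ n /\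
      (N%:R ^+ n.+1)^-1 <= `|u i0 + theta * u i1|.
  - exact: (good_separated hL b1 v0 v1 hv th01 slope Gt Gt').
  - exact: powR_ge0.
  apply: le_trans Mn _; rewrite powR_expV // ge0_ler_powR ?nnegrE ?(ltW gamma_gt0) ?invr_ge0 ?exprn_ge0 ?mulr_ge0 //.
  have Np : 0 < N%:R :> R by rewrite ltr0n.
  have -> : (N%:R ^+ n)^-1 = N%:R * (N%:R ^+ n.+1)^-1 :> R.
    by rewrite exprS invfM mulrA divff ?mul1r // gt_eqF.
  rewrite [2 * _]mulrC -mulrA ler_pM2l //; exact: le_trans nw hw.
have [f [fp fhol]] := hoelder_extension gamma_gt0 (ltW gamma_lt1) C0 Gn0 hol.
exists f, nu; split.
- exists C => y y'; apply: le_trans (fhol y y') _; rewrite ler_wpM2l //.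
  rewrite ge0_ler_powR ?nnegrE ?(ltW gamma_gt0) ?sqrtr_ge0 //.
  rewrite [leLHS]/Num.Def.normr /= mx_normrE; apply/bigmax_leP; split => [|[i j] _ /=].
    by rewrite sqrtr_ge0.
  by rewrite ord1; exact: abs_le_enorm.
- have [eta etaE] := ex_code_measure R leL.
  exists eta, g; split => //.
  + exact: code_measure_cube etaE.
  + exact: code_measure_similar etaE.
  move=> A mA; rewrite nuE; apply: (lebesgue_coding_preimage leL _ etaE); first by exists e'.
  by have := mgc measurableT A mA; rewrite setTI.
- exact: (doubling_coding leL _ eK e'K giso gsurj nuE).
rewrite nuE; apply: lt_le_trans Ggt0 _; apply: le_lebesgue => t Gt /=.
exists (p t) => //; apply: graph_pointE; exact: fp.
Qed.
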